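(* Let $\lambda=(N,\psi,O,R,\{e_i\})$ be an s-space over a manifold $M$ such that $O$ acts on $N$ without fixed points, i.e. if $z.a=z$ for some $z\in N$ and $a\in O$, then $a=e$ (the unit of $O$). Then $(N,\psi,O,R)$ is a principal fiber bundle over $M$.
   Context: All manifolds and maps are smooth; $M_p$ denotes the tangent space of $M$ at $p$. An s-space over an $n$-dimensional manifold $M$ is a collection $\lambda=(N,\psi,O,R,\{e_i\})$ where: (a) $N$ is a manifold; (b) $\psi:N\to M$ is a surjective submersion; (c) $O$ is a Lie group and $R$ is a right action of $O$ on $N$, written $R_a(z)=z.a$, with $\psi\circ R_a=\psi$ for all $a\in O$, and transitive on each fiber of $\psi$; (d) $e_i:N\to TM$, $1\le i\le n$, are differentiable functions such that $\{e_1(z),\dots,e_n(z)\}$ is a basis of $M_{\psi(z)}$ for all $z\in N$. All s-spaces are assumed to have rigid base change: there is a differentiable map $L:O\to GL(n)$ (the base change morphism, which is a group morphism) such that $e_i(z.a)=\sum_{l=1}^n e_l(z)L(a)^l_i$ for all $z\in N$, $a\in O$, $1\le i\le n$. *)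

(* Defs.v *)
From HB Require Import structures.
From mathcomp Require Import all_boot all_order all_algebra.
From mathcomp Require Import all_classical all_reals all_analysis.
From mathcomp Require Import lra.
Set Implicit Arguments.
Unset Strict Implicit.
Unset Printing Implicit Defensive.
Import Order.TTheory GRing.Theory Num.Theory.
Import numFieldNormedType.Exports.
Local Open Scope classical_set_scope.
Local Open Scope ring_scope.

Local Obligation Tactic := idtac.

Section Manifolds.
Variable R : realType.

(* [U] is meant to be open.  As ['d f x] is linear, this amounts to the existence
   and continuity of all partial derivatives of order at most [k]. *)
Fixpoint Ck (m p k : nat) (U : set 'rV[R]_m) (f : 'rV[R]_m -> 'rV[R]_p) :
    Prop :=
  match k with
  | 0 => forall x, U x -> {for x, continuous f}
  | k'.+1 => (forall x, U x -> differentiable f x) /\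
             (forall v, Ck k' U (fun x => 'd f x v))
  end.

Definition Cinf (m p : nat) (U : set 'rV[R]_m) (f : 'rV[R]_m -> 'rV[R]_p) :=
  forall k, Ck k U f.

Lemma near_is_diff (m p : nat) (f g : 'rV[R]_m -> 'rV[R]_p) x :
  (\forall y \near x, f y = g y) -> differentiable f x ->
  is_diff x g ('d f x).
Proof.
move=> fg df.
have dfc : continuous ('d f x) by exact: diff_continuous.
have e : g \o shift x = cst (g x) + 'd f x +o_ (0 : 'rV[R]_m) id.
  have fgx : f x = g x := nbhs_singleton fg.
  have /eqaddoP h := diff_locally df.
  apply/eqaddoP => eps eps0; have := h eps eps0.
  have : \forall y \near (0 : 'rV[R]_m), f (y + x) = g (y + x).
    by move: fg; rewrite (near_shift 0)/= subr0.
  apply: filterS2 => y e1 h1; rewrite [X in `|X|](_ : _ =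
    (f \o shift x - (cst (f x) + 'd f x)) y)//.
  by rewrite -[LHS]/(g (y + x) - (g x + 'd f x y)) -e1 -fgx.
have dE := diff_unique dfc e.
apply: DiffDef; last exact: dE.
apply/diff_locallyP; rewrite dE; split; [exact: dfc|exact: e].
Qed.

Lemma near_diff (m p : nat) (f g : 'rV[R]_m -> 'rV[R]_p) x :
  (\forall y \near x, f y = g y) -> differentiable f x ->
  forall v, 'd g x v = 'd f x v.
Proof.
move=> fg df v; have [_ e] := near_is_diff fg df.
exact: (congr1 (fun h => h v) e).
Qed.

Lemma near_differentiable (m p : nat) (f g : 'rV[R]_m -> 'rV[R]_p) x :
  (\forall y \near x, f y = g y) -> differentiable f x -> differentiable g x.
Proof. by move=> fg df; case: (near_is_diff fg df). Qed.

Lemma open_near_eq (T : topologicalType) (S : Type) (U : set T)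
    (f g : T -> S) x :
  open U -> U x -> (forall y, U y -> f y = g y) -> \forall y \near x, f y = g y.
Proof. by move=> oU Ux fg; apply: filterS (open_nbhs_nbhs (conj oU Ux)). Qed.

Lemma Ck_eq (m p k : nat) (U : set 'rV[R]_m) (f g : 'rV[R]_m -> 'rV[R]_p) :
  open U -> (forall x, U x -> f x = g x) -> Ck k U f -> Ck k U g.
Proof.
move=> oU; elim: k f g => [|k IH] f g fg /=.
  move=> cf x Ux; have fgx := open_near_eq oU Ux fg.
  have := cf x Ux; rewrite /prop_for /continuous_at (fg x Ux).
  move=> h; apply: cvg_trans h; exact: (near_eq_cvg fgx).
case=> df dfk; split=> [x Ux|v].
  exact: (near_differentiable (open_near_eq oU Ux fg) (df x Ux)).
apply: IH (dfk v) => x Ux.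
exact/esym/(near_diff (open_near_eq oU Ux fg) (df x Ux)).
Qed.

Lemma Ck_sub (m p k : nat) (U V : set 'rV[R]_m) (f : 'rV[R]_m -> 'rV[R]_p) :
  V `<=` U -> Ck k U f -> Ck k V f.
Proof.
move=> VU; elim: k f => [|k IH] f /=; first by move=> cf x /VU; exact: cf.
by case=> df dfk; split=> [x /VU|v]; [exact: df|exact: IH].
Qed.

Lemma Ck_le1 (m p k : nat) (U : set 'rV[R]_m) (f : 'rV[R]_m -> 'rV[R]_p) :
  Ck k.+1 U f -> Ck k U f.
Proof.
elim: k f => [|k IH] f; first
  by case=> df _ x Ux; apply/differentiable_continuous/df.
by case=> df dfk; split => // v; apply/IH/dfk.
Qed.

Lemma Ck_add (m p k : nat) (U : set 'rV[R]_m) (f g : 'rV[R]_m -> 'rV[R]_p) :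
  open U -> Ck k U f -> Ck k U g -> Ck k U (fun x => f x + g x).
Proof.
move=> oU; elim: k f g => [|k IH] f g /=.
  move=> cf cg x Ux; have cfx := cf x Ux; have cgx := cg x Ux.
  exact: (@continuousD _ _ _ f g x cfx cgx).
case=> df dfk [dg dgk]; split=> [x Ux|v].
  exact: (differentiableD (df x Ux) (dg x Ux)).
apply: (Ck_eq oU _ (IH _ _ (dfk v) (dgk v))) => x Ux.
exact: (esym (congr1 (fun h => h v) (diffD (df x Ux) (dg x Ux)))).
Qed.

Lemma Ck_cst (m p k : nat) (U : set 'rV[R]_m) (c : 'rV[R]_p) : Ck k U (fun=> c).
Proof.
elim: k c => [|k IH] c /=.
  by move=> x _; exact: (@cst_continuous _ _ c x).
split=> [x _|v]; first exact: (differentiable_cst c x).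
rewrite (_ : (fun x => _) = fun=> 0); first exact: IH.
by apply/funext => x; exact: (congr1 (fun h => h v) (diff_cst c x)).
Qed.

Lemma Ck_linr (m p q k : nat) (U : set 'rV[R]_m) (f : 'rV[R]_m -> 'rV[R]_p)
    (L : {linear 'rV[R]_q -> 'rV[R]_m}) : continuous L -> open U ->
  Ck k U f -> Ck k (L @^-1` U) (f \o L).
Proof.
move=> cL oU; elim: k f => [|k IH] f /=.
  move=> cf x Ux; have cfx := cf _ Ux.
  exact: (continuous_comp (cL x) cfx).
have dL x := linear_differentiable x cL.
case=> df dfk; split=> [x Ux|v].
  exact: (differentiable_comp (dL x) (df _ Ux)).
have oLU : open (L @^-1` U) by apply: open_comp => // x _; exact: cL.
apply: (Ck_eq oLU _ (IH _ (dfk (L v)))) => x Ux /=.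
rewrite (congr1 (fun h => h v) (diff_comp (dL x) (df _ Ux))) /=.
by congr ('d f (L x) _); rewrite (congr1 (fun h => h v) (diff_lin x cL)).
Qed.

Lemma Ck_linl (m p q k : nat) (U : set 'rV[R]_m) (f : 'rV[R]_m -> 'rV[R]_p)
    (L : {linear 'rV[R]_p -> 'rV[R]_q}) : continuous L -> open U ->
  Ck k U f -> Ck k U (L \o f).
Proof.
move=> cL oU; elim: k f => [|k IH] f /=.
  move=> cf x Ux; have cfx := cf _ Ux.
  exact: (continuous_comp cfx (cL (f x))).
have dL x := linear_differentiable x cL.
case=> df dfk; split=> [x Ux|v].
  exact: (differentiable_comp (df _ Ux) (dL _)).
apply: (Ck_eq oU _ (IH _ (dfk v))) => x Ux /=.
rewrite (congr1 (fun h => h v) (diff_comp (df _ Ux) (dL _))) /=.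
by rewrite (congr1 (fun h => h _) (diff_lin (f x) cL)).
Qed.

Lemma linear_rV_cts (m p : nat) (L : {linear 'rV[R]_m -> 'rV[R]_p}) :
  continuous L.
Proof.
have -> : L = (fun v => \sum_i v ord0 i *: L (delta_mx ord0 i)) :> (_ -> _).
  apply/funext => v; rewrite {1}[v]row_sum_delta linear_sum.
  by apply: eq_bigr => i _; rewrite linearZ.
apply: (continuous_big add_continuous) => i _ v.
have h := @coord_continuous R 1 m ord0 i v.
exact: (continuous_comp h
  (@scalel_continuous R _ (L (delta_mx ord0 i)) (v ord0 i))).
Qed.

Lemma scale_is_bilinear (p : nat) :
  bilinear_for (GRing.Scale.Law.clone _ _ *:%R _)
    (GRing.Scale.Law.clone _ _ *:%R _) (@GRing.scale R 'rV[R]_p).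
Proof.
split=> [u'|u] b v w /=; first by rewrite scalerDl -scalerA.
by rewrite scalerDr !scalerA [u * b]mulrC.
Qed.
HB.instance Definition _ (p : nat) := bilinear_isBilinear.Build
  R R 'rV[R]_p 'rV[R]_p _ _ (@GRing.scale R 'rV[R]_p) (scale_is_bilinear p).

Lemma is_diff_scale (m p : nat) (a : {linear 'rV[R]_m -> R})
    (f : 'rV[R]_m -> 'rV[R]_p) x : continuous a -> differentiable f x ->
  is_diff x (fun y => a y *: f y) (fun v => a v *: f x + a x *: 'd f x v).
Proof.
move=> ca df.
pose S : {bilinear R -> 'rV[R]_p -> 'rV[R]_p} := @GRing.scale R 'rV[R]_p.
have cS : continuous (fun q : R * 'rV[R]_p => S q.1 q.2).
  by move=> q; exact: (@scale_continuous R 'rV[R]_p q).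
have da : differentiable a x := linear_differentiable x ca.
have dp := differentiable_pair da df.
have dS := @differentiable_bilin _ _ _ _ S (a x, f x) cS.
apply: DiffDef; first exact: (differentiable_comp dp dS).
have e := diff_comp dp dS.
apply: etrans e _; apply/funext => v /=.
rewrite (congr1 (fun h => h _) (@diff_bilin _ _ _ _ S (a x, f x) cS)).
rewrite (congr1 (fun h => h v) (diff_pair da df)) /=.
rewrite addrC; congr (_ + _).
by rewrite (congr1 (fun h => h v) (diff_lin x ca)).
Qed.

Lemma Ck_scale (m p k : nat) (U : set 'rV[R]_m) (a : {linear 'rV[R]_m -> R})
    (f : 'rV[R]_m -> 'rV[R]_p) : continuous a -> open U ->
  Ck k U f -> Ck k U (fun y => a y *: f y).
Proof.
move=> ca oU; elim: k f => [|k IH] f.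
  move=> cf x Ux; have cfx := cf x Ux; have cax := ca x.
  exact: (@cvgZ R 'rV[R]_p 'rV[R]_m (nbhs x) _ a f (a x) (f x) cax cfx).
move=> fk; case: (fk) => df dfk; split=> [x Ux|v].
  by case: (is_diff_scale ca (df x Ux)).
have h : Ck k U (fun x => a v *: f x + a x *: 'd f x v).
  apply: (Ck_add oU _ (IH _ (dfk v))).
  pose L : {linear 'rV[R]_p -> 'rV[R]_p} := *:%R (a v).
  exact: (Ck_linl (L := L) (@linear_rV_cts _ _ L) oU (Ck_le1 fk)).
apply: (Ck_eq oU _ h) => x Ux.
have [_ e] := is_diff_scale ca (df x Ux).
exact: (esym (congr1 (fun h => h v) e)).
Qed.

Lemma Ck_sum (m p k q : nat) (U : set 'rV[R]_m)
    (f : 'I_q -> 'rV[R]_m -> 'rV[R]_p) :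
  open U -> (forall i, Ck k U (f i)) -> Ck k U (fun x => \sum_i f i x).
Proof.
move=> oU fk.
have -> : (fun x => \sum_i f i x) = \sum_i f i.
  by apply/funext => x; rewrite fct_sumE.
elim/big_ind : _ => [|g h gk hk|i _]; last exact: fk.
  exact: Ck_cst.
exact: (Ck_add oU gk hk).
Qed.

Lemma row_mx_lin (p q : nat) :
  exists (L1 : {linear 'rV[R]_p -> 'rV[R]_(p + q)})
         (L2 : {linear 'rV[R]_q -> 'rV[R]_(p + q)}),
  forall v w, row_mx v w = L1 v + L2 w.
Proof.
have l1 : linear (fun v : 'rV[R]_p => row_mx v (0 : 'rV[R]_q)).
  by move=> a u v; rewrite scale_row_mx add_row_mx scaler0 addr0.
have l2 : linear (fun v : 'rV[R]_q => row_mx (0 : 'rV[R]_p) v).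
  by move=> a u v; rewrite scale_row_mx add_row_mx scaler0 addr0.
pose M1 := GRing.isLinear.Build _ _ _ _ _ l1.
pose M2 := GRing.isLinear.Build _ _ _ _ _ l2.
pose L1 : {linear 'rV[R]_p -> 'rV[R]_(p + q)} :=
  HB.pack (fun v : 'rV[R]_p => row_mx v (0 : 'rV[R]_q)) M1.
pose L2 : {linear 'rV[R]_q -> 'rV[R]_(p + q)} :=
  HB.pack (fun v : 'rV[R]_q => row_mx (0 : 'rV[R]_p) v) M2.
by exists L1, L2 => v w /=; rewrite add_row_mx addr0 add0r.
Qed.

Lemma Ck_id (m k : nat) (U : set 'rV[R]_m) : Ck k U id.
Proof.
case: k => [|k] /=; first by move=> x _; exact: cvg_id.
have cid : continuous (idfun : 'rV[R]_m -> 'rV[R]_m) by move=> x; exact: cvg_id.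
split=> [x _|v]; first exact: (linear_differentiable x cid).
rewrite (_ : (fun x => _) = fun=> v); first exact: Ck_cst.
by apply/funext => x; exact: (congr1 (fun h => h v) (diff_lin x cid)).
Qed.

Lemma Ck_row_mx (m p q k : nat) (U : set 'rV[R]_m) (f : 'rV[R]_m -> 'rV[R]_p)
    (g : 'rV[R]_m -> 'rV[R]_q) : open U ->
  Ck k U f -> Ck k U g -> Ck k U (fun x => row_mx (f x) (g x)).
Proof.
move=> oU fk gk; have [L1 [L2 E]] := row_mx_lin p q.
have h := Ck_add oU (Ck_linl (@linear_rV_cts _ _ L1) oU fk)
  (Ck_linl (@linear_rV_cts _ _ L2) oU gk).
by apply: (Ck_eq oU _ h) => x _ /=; rewrite E.
Qed.

Lemma row_mx_cts (T : topologicalType) (m p : nat) (f : T -> 'rV[R]_m)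
    (g : T -> 'rV[R]_p) x : {for x, continuous f} -> {for x, continuous g} ->
  {for x, continuous (fun y => row_mx (f y) (g y))}.
Proof.
move=> cf cg; have [L1 [L2 E]] := row_mx_lin m p.
have -> : (fun y => row_mx (f y) (g y)) = (L1 \o f) + (L2 \o g).
  by apply/funext => y; exact: E.
apply: continuousD.
  exact: (continuous_comp cf (@linear_rV_cts _ _ L1 _)).
exact: (continuous_comp cg (@linear_rV_cts _ _ L2 _)).
Qed.

Lemma Ck_diff (m p k : nat) (U : set 'rV[R]_m) (f : 'rV[R]_m -> 'rV[R]_p) :
  open U -> Ck k.+1 U f ->
  Ck k (lsubmx @^-1` U : set 'rV[R]_(m + m))
    (fun u => 'd f (lsubmx u) (rsubmx u)).
Proof.
move=> oU [df dfk].
pose l : {linear 'rV[R]_(m + m) -> 'rV[R]_m} := lsubmx.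
have cl : continuous l by move=> u; exact: continuous_lsubmx.
have cr : continuous (rsubmx : 'rV[R]_(m + m) -> 'rV[R]_m).
  by move=> u; exact: continuous_rsubmx.
have oV : open (l @^-1` U) by apply: open_comp => // x _; exact: cl.
have cP (i : 'I_m) : linear (fun u : 'rV[R]_(m + m) => (rsubmx u ord0 i : R)).
  by move=> a u v; rewrite !mxE.
pose c (i : 'I_m) : {linear 'rV[R]_(m + m) -> R} :=
  HB.pack (fun u : 'rV[R]_(m + m) => (rsubmx u ord0 i : R))
    (GRing.isLinear.Build _ _ _ _ _ (cP i)).
have cc i : continuous (c i).
  move=> u; have h := @coord_continuous R 1 m ord0 i (rsubmx u).
  exact: (continuous_comp (cr u) h).
have h : Ck k (l @^-1` U)
    (fun u => \sum_i c i u *: 'd f (l u) (delta_mx ord0 i)).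
  apply: (Ck_sum oV) => i; apply: (Ck_scale (cc i) oV).
  exact: (Ck_linr cl oU (dfk (delta_mx ord0 i))).
apply: (Ck_eq oV _ h) => u _.
rewrite [in RHS](row_sum_delta (rsubmx u)) linear_sum.
by apply: eq_bigr => i _; rewrite linearZ.
Qed.

(* A homeomorphism from the open set [cdom] onto the open set [ccod]; the total
   functions [cmap] and [cinv] are irrelevant outside these sets. *)
Record chart (M : topologicalType) (n : nat) := Chart {
  cdom : set M;
  ccod : set 'rV[R]_n;
  cmap :> M -> 'rV[R]_n;
  cinv : 'rV[R]_n -> M;
  cdom_open : open cdom;
  ccod_open : open ccod;
  cmap_cod : forall x, cdom x -> ccod (cmap x);
  cinv_dom : forall u, ccod u -> cdom (cinv u);
  cmapK : forall x, cdom x -> cinv (cmap x) = x;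
  cinvK : forall u, ccod u -> cmap (cinv u) = u;
  cmap_cts : forall x, cdom x -> {for x, continuous cmap};
  cinv_cts : forall u, ccod u -> {for u, continuous cinv} }.
Arguments cdom_open {M n} c.
Arguments ccod_open {M n} c.
Arguments cmap_cod {M n} c {x} _.
Arguments cinv_dom {M n} c {u} _.
Arguments cmapK {M n} c {x} _.
Arguments cinvK {M n} c {u} _.
Arguments cmap_cts {M n} c {x} _.
Arguments cinv_cts {M n} c {u} _.

Definition trans_dom (M : topologicalType) (n : nat) (c d : chart M n) :=
  ccod c `&` cinv c @^-1` cdom d.

(* The atlas is the family [mchart]; it need not be maximal, and smoothness only
   depends on the maximal atlas it generates.  Manifolds are Hausdorff and second
   countable, of pure dimension [n] (possibly 0). *)
Record manifold (n : nat) := Manifold {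
  mtop :> topologicalType;
  midx : Type;
  mchart : midx -> chart mtop n;
  mcover : forall x, exists i, cdom (mchart i) x;
  mcompat : forall i j,
    Cinf (trans_dom (mchart i) (mchart j)) (mchart j \o cinv (mchart i));
  mhausdorff : hausdorff_space mtop;
  msecond_countable : @second_countable mtop }.
Arguments mcover {n m} x.
Arguments mcompat {n m} i j.
Arguments mhausdorff {n} m.
Arguments msecond_countable {n} m.

Lemma openP (T : topologicalType) (A : set T) :
  (forall x, A x -> exists B, [/\ open B, B x & B `<=` A]) -> open A.
Proof.
move=> h; rewrite openE => x /h[B [oB Bx BA]].
by apply: filterS BA _; exact: open_nbhs_nbhs.
Qed.

Lemma open_pre (S T : topologicalType) (f : S -> T) (D : set S) (A : set T) :
  open D -> (forall x, D x -> {for x, continuous f}) -> open A ->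
  open (D `&` f @^-1` A).
Proof.
move=> oD cf oA; rewrite openE => x [Dx Ax].
have h1 : nbhs x D by exact: open_nbhs_nbhs.
have h2 : nbhs (f x) A by exact: open_nbhs_nbhs.
by apply: filterI => //; exact: (cf x Dx _ h2).
Qed.

Lemma trans_dom_open (M : topologicalType) (n : nat) (c d : chart M n) :
  open (trans_dom c d).
Proof.
exact: (open_pre (ccod_open c) (@cinv_cts _ _ c) (cdom_open d)).
Qed.

Arguments trans_dom_open {M n} c d.

Lemma rV_second_countable (n : nat) : @second_countable 'rV[R]_n.
Proof.
pose b (q : 'rV[rat]_n * rat) : set 'rV[R]_n :=
  (ball (map_mx ratr q.1 : 'rV[R]_n) (ratr q.2 : R)).
exists (b @` [set q | 0 < (ratr q.2 : R)]).
  exact: (sub_countable (card_image_le _ _) (countableP _)).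
split=> [_ [q /= q0 <-]|x A /nbhs_ballP [e /= e0 xA]].
  exact: ball_open.
have [r /andP[r0 re]] : exists r : rat, (0 < (ratr r : R) < e / 2).
  have [r] := rat_in_itvoo (divr_gt0 e0 (ltr0n R 2)).
  by rewrite in_itv /=; exists r.
have hq (j : 'I_n) : exists q : rat, `|x ord0 j - ratr q| < (ratr r : R).
  have h : x ord0 j - ratr r < x ord0 j + (ratr r : R) by lra.
  have [q] := rat_in_itvoo h; rewrite in_itv /= => /andP[h1 h2].
  by exists q; rewrite ltr_norml; lra.
pose q : 'rV[rat]_n := \row_j projT1 (cid (hq j)).
have xq : ball (map_mx ratr q : 'rV[R]_n) (ratr r : R) x.
  rewrite /ball /=; split=> // i j; rewrite ord1 !mxE.
  by case: (cid (hq j)) => /= s; rewrite -ball_normE /= distrC.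
exists (b (q, r)); first by split=> //; exists (q, r).
apply: subset_trans xA => y yq.
have re2 : ratr r + ratr r <= e by lra.
by apply: (le_ball re2); apply: ball_triangle yq; exact: ball_sym.
Qed.

Lemma rV_hausdorff (n : nat) : hausdorff_space 'rV[R]_n.
Proof. exact: norm_hausdorff. Qed.

Lemma prod_hausdorff (S T : topologicalType) :
  hausdorff_space S -> hausdorff_space T -> hausdorff_space (S * T)%type.
Proof.
move=> hS hT [x y] [x' y'] h; congr pair.
  apply: hS => A B xA xB.
  have [] := h (A `*` setT) (B `*` setT).
  - by exists (A, setT) => //; split=> //; exact: filterT.
  - by exists (B, setT) => //; split=> //; exact: filterT.
  by move=> [a b] [[/= Aa _] [/= Ba _]]; exists a.
apply: hT => A B xA xB.
have [] := h (setT `*` A) (setT `*` B).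
- by exists (setT, A) => //; split=> //; exact: filterT.
- by exists (setT, B) => //; split=> //; exact: filterT.
by move=> [a b] [[/= _ Aa] [/= _ Ba]]; exists b.
Qed.

Lemma prod_open (S T : topologicalType) (A : set S) (B : set T) :
  open A -> open B -> open (A `*` B).
Proof.
move=> oA oB; rewrite openE => -[x y] [/= Ax By]; exists (A, B) => //.
by split; exact: open_nbhs_nbhs.
Qed.

Lemma prod_second_countable (S T : topologicalType) :
  @second_countable S -> @second_countable T -> @second_countable (S * T)%type.
Proof.
move=> [A cA [oA bA]] [B cB [oB bB]].
exists [set C | exists2 p : set S * set T, (A `*` B) p & C = p.1 `*` p.2].
  have -> : [set C | exists2 p : set S * set T, (A `*` B) p & C = p.1 `*` p.2] =
     (fun p : set S * set T => p.1 `*` p.2) @` (A `*` B).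
    by apply/seteqP; split=> C [p ABp E]; exists p.
  exact: (sub_countable (card_image_le _ _) (countableX cA cB)).
split=> [_ [[U V] [/= AU BV] ->]|[x y] C [[U V] [/= xU yV] UVC]].
  by apply: prod_open; [exact: oA|exact: oB].
have [U' [AU' U'x] U'U] := bA x U xU.
have [V' [BV' V'y] V'V] := bB y V yV.
exists (U' `*` V'); first by split=> //; exists (U', V').
by apply: subset_trans UVC => -[a b] [/= /U'U ? /V'V ?].
Qed.

Section Product.
Variables (m p : nat).

Section ProductChart.
Variables (S T : topologicalType) (c : chart S m) (d : chart T p).

Let pmap (z : S * T) : 'rV[R]_(m + p) := row_mx (c z.1) (d z.2).
Let pinv (u : 'rV[R]_(m + p)) : S * T :=
  (cinv c (lsubmx u), cinv d (rsubmx u)).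
Let pcod : set 'rV[R]_(m + p) :=
  [set u | ccod c (lsubmx u) /\ ccod d (rsubmx u)].

Lemma split_open (A : set 'rV[R]_m) (B : set 'rV[R]_p) : open A -> open B ->
  open [set u : 'rV[R]_(m + p) | A (lsubmx u) /\ B (rsubmx u)].
Proof.
move=> oA oB; apply: openI.
  by apply: open_comp => // u _; exact: continuous_lsubmx.
by apply: open_comp => // u _; exact: continuous_rsubmx.
Qed.

Program Definition prod_chart : chart (S * T)%type (m + p) :=
  @Chart (S * T)%type (m + p) (cdom c `*` cdom d) pcod pmap pinv
    _ _ _ _ _ _ _ _.
Next Obligation. exact: prod_open (cdom_open c) (cdom_open d). Qed.
Next Obligation. exact: split_open (ccod_open c) (ccod_open d). Qed.
Next Obligation.
move=> [x y] [/= cx dy]; rewrite /pcod /pmap /= row_mxKl row_mxKr.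
by split; exact: cmap_cod.
Qed.
Next Obligation. by move=> u [cu du]; split; exact: cinv_dom. Qed.
Next Obligation.
by move=> [x y] [/= cx dy]; rewrite /pinv /pmap /= row_mxKl row_mxKr !cmapK.
Qed.
Next Obligation.
by move=> u [cu du]; rewrite /pmap /pinv /= !cinvK // hsubmxK.
Qed.
Next Obligation.
move=> [x y] [/= cx dy].
have f1 : {for (x, y), continuous (@fst S T)} by exact: cvg_fst.
have f2 : {for (x, y), continuous (@snd S T)} by exact: cvg_snd.
apply: row_mx_cts.
  exact: (continuous_comp f1 (cmap_cts c cx)).
exact: (continuous_comp f2 (cmap_cts d dy)).
Qed.
Next Obligation.
move=> u [cu du].
have h1 := continuous_comp (@continuous_lsubmx R 1 m p u) (cinv_cts c cu).
have h2 := continuous_comp (@continuous_rsubmx R 1 m p u) (cinv_cts d du).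
exact: cvg_pair h1 h2.
Qed.
End ProductChart.

Program Definition prod_manifold (M : manifold m) (N : manifold p) :
    manifold (m + p) :=
  @Manifold (m + p) (M * N)%type (midx M * midx N)%type
    (fun i => prod_chart (mchart i.1) (mchart i.2)) _ _ _ _.
Next Obligation.
move=> M N [x y]; have [i ix] := mcover x; have [j jy] := mcover y.
by exists (i, j).
Qed.
Next Obligation.
move=> M N [i j] [i' j'] k /=.
pose l : {linear 'rV[R]_(m + p) -> 'rV[R]_m} := lsubmx.
pose r : {linear 'rV[R]_(m + p) -> 'rV[R]_p} := rsubmx.
have cl : continuous l by move=> u; exact: continuous_lsubmx.
have cr : continuous r by move=> u; exact: continuous_rsubmx.
have h1 := Ck_linr cl (trans_dom_open (mchart i) (mchart i')) (mcompat i i' k).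
have h2 := Ck_linr cr (trans_dom_open (mchart j) (mchart j')) (mcompat j j' k).
have oD := split_open (trans_dom_open (mchart i) (mchart i'))
  (trans_dom_open (mchart j) (mchart j')).
have h : Ck k [set u : 'rV[R]_(m + p) |
    trans_dom (mchart i) (mchart i') (lsubmx u) /\
    trans_dom (mchart j) (mchart j') (rsubmx u)]
    (fun u => row_mx (((mchart i') \o cinv (mchart i) \o l) u)
                     (((mchart j') \o cinv (mchart j) \o r) u)).
  by apply: Ck_row_mx => //; [apply: Ck_sub h1|apply: Ck_sub h2] => u [].
by apply: Ck_sub h => u [[/= ? ?] [/= ? ?]].
Qed.
Next Obligation.
by move=> M N; apply: prod_hausdorff; exact: mhausdorff.
Qed.
Next Obligation.
by move=> M N; apply: prod_second_countable; exact: msecond_countable.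
Qed.
End Product.

Program Definition euclidean (n : nat) : manifold n :=
  @Manifold n 'rV[R]_n unit
    (fun _ => @Chart 'rV[R]_n n setT setT id id _ _ _ _ _ _ _ _) _ _ _ _.
Next Obligation. by move=> *; exact: openT. Qed.
Next Obligation. by move=> *; exact: openT. Qed.
Next Obligation. by []. Qed.
Next Obligation. by []. Qed.
Next Obligation. by []. Qed.
Next Obligation. by []. Qed.
Next Obligation. by move=> n _ x _; exact: cvg_id. Qed.
Next Obligation. by move=> n _ x _; exact: cvg_id. Qed.
Next Obligation. by move=> n x; exists tt. Qed.
Next Obligation.
move=> n [] [] k.
exact: Ck_id.
Qed.
Next Obligation. by move=> n; exact: rV_hausdorff. Qed.
Next Obligation. by move=> n; exact: rV_second_countable. Qed.

(* By continuity of [f] at [x], the local expression of [f] is meaningful near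
   [mchart i x], so that [W] can be shrunk to avoid irrelevant values. *)
Definition smooth_at (m n : nat) (M : manifold m) (N : manifold n)
    (f : M -> N) (x : M) :=
  {for x, continuous f} /\
  forall (i : midx M) (j : midx N),
    cdom (mchart i) x -> cdom (mchart j) (f x) ->
  exists W, [/\ open W, W (mchart i x) &
    Cinf W (mchart j \o f \o cinv (mchart i))].

Definition smooth (m n : nat) (M : manifold m) (N : manifold n)
  (f : M -> N) := forall x, smooth_at f x.

Section TangentSpace.
Variables (n : nat) (M : manifold n).

Definition charts_at (x : M) := {i : midx M | cdom (mchart i) x}.

Definition trans (i j : midx M) : 'rV[R]_n -> 'rV[R]_n :=
  mchart j \o cinv (mchart i).

(* A tangent vector at [x] is a family of coordinate vectors, one for each chart
   around [x], related by the differentials of the transition maps. *)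
Definition is_tangent (x : M) : {pred charts_at x -> 'rV[R]_n} :=
  fun v => `[< forall i j : charts_at x,
    v j = 'd (trans (sval i) (sval j)) (mchart (sval i) x) (v i) >].

Lemma trans_differentiable (i j : midx M) (x : M) :
  cdom (mchart i) x -> cdom (mchart j) x ->
  differentiable (trans i j) (mchart i x).
Proof.
move=> ix jx; have [h _] := mcompat i j 1; apply: h.
by split; [exact: cmap_cod|rewrite /= cmapK].
Qed.

Lemma trans_domx (i j : midx M) (x : M) :
  cdom (mchart i) x -> cdom (mchart j) x ->
  trans_dom (mchart i) (mchart j) (mchart i x).
Proof. by move=> ix jx; split; [exact: cmap_cod|rewrite /= cmapK]. Qed.

Lemma trans_chain (i j k : midx M) (x : M) u :
  cdom (mchart i) x -> cdom (mchart j) x -> cdom (mchart k) x ->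
  'd (trans j k) (mchart j x) ('d (trans i j) (mchart i x) u) =
  'd (trans i k) (mchart i x) u.
Proof.
move=> ix jx kx.
have d1 := trans_differentiable ix jx.
have e : trans i j (mchart i x) = mchart j x by rewrite /trans /= cmapK.
have d2 : differentiable (trans j k) (trans i j (mchart i x)).
  by rewrite e; exact: trans_differentiable.
have dc := differentiable_comp d1 d2.
have E := congr1 (fun h => h u) (diff_comp d1 d2).
rewrite -[in LHS]e; apply: (etrans (esym E)).
have h w : trans_dom (mchart i) (mchart j) w ->
    (trans j k \o trans i j) w = trans i k w.
  by move=> [wi wj]; rewrite /trans /= cmapK.
have oD := trans_dom_open (mchart i) (mchart j).
exact/esym/(near_diff (open_near_eq oD (trans_domx ix jx) h) dc).
Qed.

Lemma trans_id (i : midx M) (x : M) u :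
  cdom (mchart i) x -> 'd (trans i i) (mchart i x) u = u.
Proof.
move=> ix; have cid : continuous (idfun : 'rV[R]_n -> 'rV[R]_n).
  by move=> y; exact: cvg_id.
have did := linear_differentiable (mchart i x) cid.
have h w : trans_dom (mchart i) (mchart i) w -> idfun w = trans i i w.
  by move=> [wi wj]; rewrite /trans /= cinvK.
have oD := trans_dom_open (mchart i) (mchart i).
apply: etrans (near_diff (open_near_eq oD (trans_domx ix ix) h) did u) _.
exact: (congr1 (fun h => h u) (diff_lin _ cid)).
Qed.

Lemma is_tangent_submod (x : M) : submod_closed (is_tangent (x:=x)).
Proof.
split; first by apply/asboolP => i j; rewrite linear0.
move=> a v w /asboolP hv /asboolP hw; apply/asboolP => i j.
by rewrite linearP/= -hv -hw.
Qed.
HB.instance Definition _ (x : M) :=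
  GRing.isSubmodClosed.Build R (charts_at x -> 'rV[R]_n) (is_tangent (x:=x))
    (is_tangent_submod x).

Definition tangent (x : M) := {v : charts_at x -> 'rV[R]_n | is_tangent v}.
HB.instance Definition _ (x : M) := SubChoice.on (tangent x).
HB.instance Definition _ (x : M) := [SubChoice_isSubLmodule of tangent x by <:].

Definition tcoord (x : M) (i : charts_at x) (v : tangent x) : 'rV[R]_n :=
  val v i.

Lemma tangent_of_subproof (x : M) (i : charts_at x) (u : 'rV[R]_n) :
  is_tangent (fun j : charts_at x =>
    'd (trans (sval i) (sval j)) (mchart (sval i) x) u).
Proof.
apply/asboolP => j k.
exact: (esym (trans_chain u (svalP i) (svalP j) (svalP k))).
Qed.

Definition tangent_of (x : M) (i : charts_at x) (u : 'rV[R]_n) : tangent x :=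
  exist (fun v => is_tangent v) _ (tangent_of_subproof i u).

Lemma tangent_ofK (x : M) (i : charts_at x) :
  cancel (tangent_of i) (tcoord i).
Proof. by move=> u; exact: (trans_id u (svalP i)). Qed.

Lemma tcoordK (x : M) (i : charts_at x) : cancel (tcoord i) (tangent_of i).
Proof.
move=> v; apply: val_inj; apply/funext => j /=.
by have /asboolP <- := valP v.
Qed.

Definition pick_chart (x : M) : charts_at x :=
  let s := cid (mcover x) in exist _ (projT1 s) (projT2 s).

Lemma tangent_vect (x : M) : Vector.axiom n (tangent x).
Proof.
exists (tcoord (pick_chart x)); first by move=> a u v.
by exists (tangent_of (pick_chart x)); [exact: tcoordK|exact: tangent_ofK].
Qed.
HB.instance Definition _ (x : M) :=
  Lmodule_hasFinDim.Build R (tangent x) (tangent_vect x).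
End TangentSpace.

Section TangentBundle.
Variables (n : nat) (M : manifold n).

Definition tbundle := {x : M & tangent x}.

Definition tb_base (p : tbundle) : M := projT1 p.

Definition tb_coord (i : midx M) (p : tbundle) : 'rV[R]_n :=
  if pselect (cdom (mchart i) (tb_base p)) is left h
  then tcoord (exist _ i h) (projT2 p) else 0.

Definition tb_map (i : midx M) (p : tbundle) : 'rV[R]_(n + n) :=
  row_mx (mchart i (tb_base p)) (tb_coord i p).

Definition tb_inv (i : midx M) (u : 'rV[R]_(n + n)) : tbundle :=
  let x := cinv (mchart i) (lsubmx u) in
  existT _ x (if pselect (cdom (mchart i) x) is left h
              then tangent_of (exist _ i h) (rsubmx u) else 0).

Definition tb_dom (i : midx M) : set tbundle :=
  [set p | cdom (mchart i) (tb_base p)].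
Definition tb_cod (i : midx M) : set 'rV[R]_(n + n) :=
  [set u | ccod (mchart i) (lsubmx u)].
Definition tb_trans_dom (i j : midx M) : set 'rV[R]_(n + n) :=
  lsubmx @^-1` trans_dom (mchart i) (mchart j).

Lemma tb_coordE (i : midx M) (x : M) (v : tangent x)
    (h : cdom (mchart i) x) :
  tb_coord i (existT _ x v) = tcoord (exist _ i h) v.
Proof.
rewrite /tb_coord /=; case: pselect => // h'.
by rewrite (Prop_irrelevance h' h).
Qed.

Lemma tb_eq (i : midx M) (p q : tbundle) : tb_dom i p ->
  tb_base p = tb_base q -> tb_coord i p = tb_coord i q -> p = q.
Proof.
case: p q => [x v] [y w]; rewrite /tb_dom/= => h e; case: y / e w => w.
rewrite !(tb_coordE _ h) => e; congr existT.
exact: (can_inj (tcoordK (exist _ i h)) e).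
Qed.

Lemma tb_inv_dom (i : midx M) u : tb_cod i u -> tb_dom i (tb_inv i u).
Proof. exact: cinv_dom. Qed.

Lemma tb_map_cod (i : midx M) p : tb_dom i p -> tb_cod i (tb_map i p).
Proof. by rewrite /tb_cod /tb_map /= row_mxKl; exact: cmap_cod. Qed.

Lemma tb_transE (i j : midx M) u : tb_trans_dom i j u ->
  tb_map j (tb_inv i u) =
  row_mx (trans i j (lsubmx u)) ('d (trans i j) (lsubmx u) (rsubmx u)).
Proof.
move=> [ui uj]; congr row_mx; rewrite /tb_inv.
rewrite (tb_coordE _ uj).
case: pselect => [h|[]]; last exact: cinv_dom.
by rewrite /tcoord /= cinvK.
Qed.

Lemma tb_invK (i : midx M) u : tb_cod i u -> tb_map i (tb_inv i u) = u.
Proof.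
move=> ui; have uii : trans_dom (mchart i) (mchart i) (lsubmx u).
  by split => //; exact: cinv_dom.
rewrite tb_transE//= -[RHS](hsubmxK u); congr row_mx.
  by rewrite /trans /= cinvK.
have := trans_id (rsubmx u) (cinv_dom (mchart i) ui).
by rewrite cinvK.
Qed.

Lemma tb_mapK (i : midx M) p : tb_dom i p -> tb_inv i (tb_map i p) = p.
Proof.
move=> pi; have h := tb_map_cod pi.
apply: (tb_eq (tb_inv_dom h)).
  by rewrite /tb_inv /tb_map/= row_mxKl cmapK.
have := tb_invK h; rewrite {1 3}/tb_map => /eq_row_mx[_].
by [].
Qed.

Lemma tb_split_open (A : set 'rV[R]_n) : open A ->
  open (lsubmx @^-1` A : set 'rV[R]_(n + n)).
Proof. by move=> oA; apply: open_comp => // u _; exact: continuous_lsubmx. Qed.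

Lemma tb_trans_dom_open (i j : midx M) : open (tb_trans_dom i j).
Proof. exact: tb_split_open (trans_dom_open _ _). Qed.
Arguments tb_trans_dom_open i j : clear implicits.

Lemma tb_trans_Cinf (i j : midx M) :
  Cinf (tb_trans_dom i j) (tb_map j \o tb_inv i).
Proof.
move=> k.
pose l : {linear 'rV[R]_(n + n) -> 'rV[R]_n} := lsubmx.
have cl : continuous l by move=> u; exact: continuous_lsubmx.
have oT := trans_dom_open (mchart i) (mchart j).
have h1 := Ck_linr cl oT (mcompat i j k).
have h2 := Ck_diff oT (mcompat i j k.+1).
have oD := tb_trans_dom_open i j.
have h := Ck_row_mx oD h1 h2.
by apply: (Ck_eq oD _ h) => u Du; rewrite /= tb_transE.
Qed.

HB.instance Definition _ := gen_eqMixin tbundle.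
HB.instance Definition _ := gen_choiceMixin tbundle.

(* The topology for which the maps [tb_map i] are homeomorphisms from open sets
   onto [tb_cod i]. *)
Definition tb_open (A : set tbundle) :=
  forall i, open (tb_cod i `&` tb_inv i @^-1` A).

Lemma tb_openT : tb_open setT.
Proof.
move=> i; rewrite preimage_setT setIT.
exact: tb_split_open (ccod_open _).
Qed.

Lemma tb_openI : setI_closed tb_open.
Proof.
move=> A B oA oB i; rewrite preimage_setI setIIr.
by apply: openI; [exact: oA|exact: oB].
Qed.

Lemma tb_open_bigcup (I : Type) (f : I -> set tbundle) :
  (forall i, tb_open (f i)) -> tb_open (\bigcup_i f i).
Proof.
move=> of_ i; rewrite preimage_bigcup setI_bigcupr.
by apply: bigcup_open => j _; exact: of_.
Qed.

HB.instance Definition _ :=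
  isOpenTopological.Build tbundle tb_openT tb_openI tb_open_bigcup.

Lemma tb_inv_cts (i : midx M) u : tb_cod i u -> {for u, continuous (tb_inv i)}.
Proof.
move=> ui A; rewrite nbhsE => -[B [oB Bu] BA].
have oB' : open (tb_cod i `&` tb_inv i @^-1` B) := oB i.
have : nbhs u (tb_cod i `&` tb_inv i @^-1` B) by exact: open_nbhs_nbhs.
by apply: filterS => w [_ /BA].
Qed.

Lemma tb_dom_open (i : midx M) : open (tb_dom i).
Proof. by move=> j; exact: tb_trans_dom_open j i. Qed.
Arguments tb_dom_open i : clear implicits.

Lemma tb_map_cts (i : midx M) p : tb_dom i p -> {for p, continuous (tb_map i)}.
Proof.
move=> pi A; rewrite nbhsE => -[B [oB Bp] BA].
have oB' : open (tb_dom i `&` tb_map i @^-1` B).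
  move=> j; rewrite (_ : _ `&` _ =
      tb_trans_dom j i `&` (tb_map i \o tb_inv j) @^-1` B); last first.
    by apply/seteqP; split=> u; [move=> [? [? ?]]|move=> [[? ?] ?]].
  apply: (open_pre (tb_trans_dom_open j i) _ oB) => u Du.
  exact: (tb_trans_Cinf j i 0%N u Du).
have : nbhs p (tb_dom i `&` tb_map i @^-1` B) by exact: open_nbhs_nbhs.
by apply: filterS => w [_ /BA].
Qed.

Definition tb_chart (i : midx M) : chart tbundle (n + n) :=
  Chart (tb_dom_open i) (tb_split_open (ccod_open (mchart i)))
    (@tb_map_cod i) (@tb_inv_dom i) (@tb_mapK i) (@tb_invK i)
    (@tb_map_cts i) (@tb_inv_cts i).

Lemma tb_cover (p : tbundle) : exists i, cdom (tb_chart i) p.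
Proof. exact: mcover. Qed.

Lemma tb_base_open (A : set M) : open A -> open (tb_base @^-1` A).
Proof.
move=> oA; suff : tb_open (tb_base @^-1` A) by [].
move=> i.
have h := open_pre (ccod_open (mchart i)) (@cinv_cts _ _ (mchart i)) oA.
exact: (tb_split_open h).
Qed.

Lemma tb_hausdorff : hausdorff_space tbundle.
Proof.
have hM := mhausdorff M.
have hV := @rV_hausdorff (n + n).
rewrite open_hausdorff in hM; rewrite open_hausdorff in hV.
rewrite open_hausdorff => p q pq.
have [e|ne] := pselect (tb_base p = tb_base q); last first.
  have /hM[[A B]/= [/set_mem Ap /set_mem Bq] [oA oB AB0]] :
    tb_base p != tb_base q by apply/eqP.
  exists (tb_base @^-1` A, tb_base @^-1` B) => /=.
    by split; exact/mem_set.
  split; [exact: tb_base_open|exact: tb_base_open|].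
  apply/eqP/seteqP; split=> // z [zA zB]; move/eqP/seteqP : AB0 => [h _].
  by apply: (h (tb_base z)).
have [i pi] := mcover (tb_base p).
have qi : tb_dom i q by rewrite /tb_dom /= -e.
have /hV[[A B]/= [/set_mem Ap /set_mem Bq] [oA oB AB0]] :
    tb_map i p != tb_map i q.
  apply: contra pq => /eqP E; apply/eqP.
  by rewrite -(tb_mapK pi) E tb_mapK.
exists (tb_dom i `&` tb_map i @^-1` A, tb_dom i `&` tb_map i @^-1` B) => /=.
  by split; exact/mem_set.
split.
- exact: (open_pre (tb_dom_open i) (@tb_map_cts i) oA).
- exact: (open_pre (tb_dom_open i) (@tb_map_cts i) oB).
apply/eqP/seteqP; split=> // z [[_ zA] [_ zB]]; move/eqP/seteqP : AB0 => [h _].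
by apply: (h (tb_map i z)).
Qed.

Lemma tb_second_countable : @second_countable tbundle.
Proof.
have [B cB [oB bB]] := msecond_countable M.
have [D cD [oD bD]] := @rV_second_countable (n + n).
pose good (b : set M) (i : midx M) := b `<=` cdom (mchart i).
pose T (p : set M * set 'rV[R]_(n + n)) : set tbundle :=
  if pselect (exists i, good p.1 i) is left h
  then let i := projT1 (cid h) in tb_dom i `&` tb_map i @^-1` p.2 else set0.
exists (T @` (B `*` D)).
  exact: (sub_countable (card_image_le _ _) (countableX cB cD)).
split=> [_ [[b d] [/= Bb Dd] <-]|p A pA].
  rewrite /T /=; case: pselect => [h|_]; last exact: open0.
  exact: (open_pre (tb_dom_open _) (@tb_map_cts _) (oD _ Dd)).
have [i pi] := mcover (tb_base p).
have ni : nbhs (tb_base p) (cdom (mchart i)).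
  by apply: open_nbhs_nbhs; split => //; exact: cdom_open.
have [b [Bb bp] bi] := bB _ _ ni.
have hb : exists i, good b i by exists i.
pose j := projT1 (cid hb).
have bj : good b j := projT2 (cid hb).
have pj : tb_dom j p by exact: bj.
have nA : nbhs (tb_map j p) (tb_cod j `&` tb_inv j @^-1` A).
  apply: filterI.
    apply: open_nbhs_nbhs; split; last exact: tb_map_cod.
    exact: tb_split_open (ccod_open _).
  by apply: (tb_inv_cts (tb_map_cod pj)); rewrite tb_mapK.
have [d [Dd dp] dA] := bD _ _ nA.
have TE : T (b, d) = tb_dom j `&` tb_map j @^-1` d.
  rewrite /T /=; case: pselect => [h|[]//].
  by rewrite (Prop_irrelevance h hb).
exists (T (b, d)).
  by split; [exists (b, d)|rewrite TE].
by rewrite TE => z [zj /dA[_ /=]]; rewrite tb_mapK.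
Qed.

Definition tangent_bundle : manifold (n + n) :=
  Manifold tb_cover tb_trans_Cinf tb_hausdorff tb_second_countable.

End TangentBundle.

(* By [tcoord_differential] below, when [f] is smooth at [x] this does not depend
   on the chosen charts. *)
Definition differential (m n : nat) (M : manifold m) (N : manifold n)
    (f : M -> N) (x : M) (v : tangent x) : tangent (f x) :=
  let i := pick_chart x in let j := pick_chart (f x) in
  tangent_of j ('d (mchart (sval j) \o f \o cinv (mchart (sval i)))
                   (mchart (sval i) x) (tcoord i v)).

Lemma tcoord_differential (m n : nat) (M : manifold m) (N : manifold n)
    (f : M -> N) (x : M) : smooth_at f x ->
  forall (i : charts_at x) (j : charts_at (f x)) (v : tangent x),
  tcoord j (differential f v) =
  'd (mchart (sval j) \o f \o cinv (mchart (sval i)))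
     (mchart (sval i) x) (tcoord i v).
Proof.
move=> [cf sf] i j v; rewrite /differential.
set i0 := pick_chart x; set j0 := pick_chart (f x).
have i0x := svalP i0; have j0x := svalP j0.
have ix := svalP i; have jx := svalP j.
have [W [oW Wx /(_ 1%N)[dF _]]] := sf _ _ i0x j0x.
set F := mchart (sval j0) \o f \o cinv (mchart (sval i0)) in dF *.
rewrite {1}/tcoord /=.
have -> : tcoord i0 v =
    'd (trans (sval i) (sval i0)) (mchart (sval i) x) (tcoord i v).
  by have /asboolP := valP v; apply.
have d1 := trans_differentiable ix i0x.
have e1 : trans (sval i) (sval i0) (mchart (sval i) x) = mchart (sval i0) x.
  by rewrite /trans /= cmapK.
have d2 : differentiable F (trans (sval i) (sval i0) (mchart (sval i) x)).
  by rewrite e1; exact: dF.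
have d12 := differentiable_comp d1 d2.
have e2 : (F \o trans (sval i) (sval i0)) (mchart (sval i) x) =
    mchart (sval j0) (f x).
  by rewrite /F /trans /= cmapK // cmapK.
have d3 : differentiable (trans (sval j0) (sval j))
    ((F \o trans (sval i) (sval i0)) (mchart (sval i) x)).
  by rewrite e2; exact: trans_differentiable.
have d123 := differentiable_comp d12 d3.
have E12 := congr1 (fun h => h (tcoord i v)) (diff_comp d1 d2).
have E123 := congr1 (fun h => h (tcoord i v)) (diff_comp d12 d3).
rewrite -[in LHS]e2 -[in X in 'd F X]e1.
apply: etrans (congr1 _ (esym E12)) _.
apply: etrans (esym E123) _.
apply/esym; apply: (near_diff _ d123).
have n1 : nbhs (mchart (sval i) x)
    (trans_dom (mchart (sval i)) (mchart (sval i0))).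
  by apply: open_nbhs_nbhs; split;
    [exact: trans_dom_open|exact: trans_domx].
have n2 : nbhs (mchart (sval i) x)
    ((f \o cinv (mchart (sval i))) @^-1` cdom (mchart (sval j0))).
  have c1 : {for mchart (sval i) x, continuous (cinv (mchart (sval i)))}.
    exact/cinv_cts/cmap_cod.
  have c2 : {for cinv (mchart (sval i)) (mchart (sval i) x), continuous f}.
    by rewrite cmapK.
  apply: (continuous_comp c1 c2); rewrite /= cmapK //.
  by apply: open_nbhs_nbhs; split; [exact: cdom_open|].
apply: filterS2 n1 n2 => w [wi wi0] wj0.
by rewrite /F /trans /= cmapK // cmapK.
Qed.

Definition submersion (m n : nat) (M : manifold m) (N : manifold n)
    (f : M -> N) :=
  smooth f /\ forall (x : M) (w : tangent (f x)),
    exists v : tangent x, differential f v = w.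

Definition smooth_on (m n : nat) (M : manifold m) (N : manifold n)
  (A : set M) (f : M -> N) := forall x, A x -> smooth_at f x.

Definition diffeomorphism_on (m n : nat) (M : manifold m) (N : manifold n)
    (A : set M) (B : set N) (f : M -> N) :=
  open A /\ open B /\ smooth_on A f /\
  exists g : N -> M, smooth_on B g /\
    [/\ (forall x, A x -> B (f x)), (forall y, B y -> A (g y)),
        (forall x, A x -> g (f x) = x) & (forall y, B y -> f (g y) = y)].

Record lie_group (k : nat) := LieGroup {
  lmanifold :> manifold k;
  lmul : lmanifold -> lmanifold -> lmanifold;
  lone : lmanifold;
  linv : lmanifold -> lmanifold;
  lmulA : associative lmul;
  lmul1g : left_id lone lmul;
  lmulg1 : right_id lone lmul;
  lmulVg : left_inverse lone linv lmul;
  lmulgV : right_inverse lone linv lmul;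
  lmul_smooth : smooth
    (fun p : prod_manifold lmanifold lmanifold => lmul p.1 p.2);
  linv_smooth : smooth linv }.

Record right_action (m k : nat) (N : manifold m) (G : lie_group k)
    (act : N -> G -> N) : Prop := RightAction {
  ract_smooth : smooth (fun p : prod_manifold N G => act p.1 p.2);
  ract1 : forall z, act z (lone G) = z;
  ractM : forall z a b, act z (lmul a b) = act (act z a) b }.

Record sspace (n : nat) (M : manifold n) := SSpace {
  ss_dimN : nat;
  ss_N : manifold ss_dimN;
  ss_psi : ss_N -> M;
  ss_psi_submersion : submersion ss_psi;
  ss_psi_surjective : forall x : M, exists z, ss_psi z = x;
  ss_dimO : nat;
  ss_O : lie_group ss_dimO;
  ss_act : ss_N -> ss_O -> ss_N;
  ss_act_action : right_action ss_act;
  ss_psi_act : forall z a, ss_psi (ss_act z a) = ss_psi z;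
  ss_act_transitive :
    forall z w, ss_psi z = ss_psi w -> exists a, ss_act z a = w;
  ss_e : 'I_n -> forall z : ss_N, tangent (ss_psi z);
  ss_e_smooth : forall i,
    smooth (fun z => existT _ (ss_psi z) (ss_e i z) : tangent_bundle M);
  ss_e_basis : forall z, basis_of fullv [tuple ss_e i z | i < n] }.

(* [L] takes its values in the open set GL(n) of invertible matrices, where
   smoothness is smoothness into the space of all matrices.  The vectors
   [e_i (z.a)] and [e_l z] live in the distinct types [tangent (psi (z.a))] and
   [tangent (psi z)], hence the comparison in the tangent bundle. *)
Definition rigid_base_change (n : nat) (M : manifold n) (lam : sspace M) :=
  exists L : ss_O lam -> 'M[R]_n,
    [/\ (forall a, L a \in unitmx),
        smooth (fun a => mxvec (L a) : euclidean (n * n)),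
        (forall a b, L (lmul a b) = L a *m L b) &
        (forall z a i,
          existT _ (ss_psi (ss_act z a)) (ss_e i (ss_act z a)) =
          existT _ (ss_psi z) (\sum_(l < n) L a l i *: ss_e l z)
            :> tangent_bundle M)].

(* Following Kobayashi and Nomizu: a free smooth right action on [N], of which
   [M] is the quotient space with smooth projection [psi], such that [N] is
   equivariantly diffeomorphic to [U * G] over a neighbourhood [U] of each point
   of [M]. *)
Record principal_bundle (n m k : nat) (M : manifold n) (N : manifold m)
    (G : lie_group k) (psi : N -> M) (act : N -> G -> N) : Prop :=
  PrincipalBundle {
  pb_action : right_action act;
  pb_free : forall z a, act z a = z -> a = lone G;
  pb_smooth : smooth psi;
  pb_surjective : forall x, exists z, psi z = x;
  pb_orbits : forall z w, psi z = psi w <-> exists a, act z a = w;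
  pb_quotient : forall V : set M, open V <-> open (psi @^-1` V);
  pb_trivial : forall x : M, exists (U : set M) (phi : N -> G),
    [/\ open U, U x,
        diffeomorphism_on (psi @^-1` U)
          (U `*` [set: G] : set (prod_manifold M G))
          (fun z => (psi z, phi z)) &
        forall z a, U (psi z) -> phi (act z a) = lmul (phi z) a] }.

End Manifolds.

Arguments cdom_open {R M n} c.
Arguments ccod_open {R M n} c.
Arguments cmap_cod {R M n} c {x} _.
Arguments cinv_dom {R M n} c {u} _.
Arguments cmapK {R M n} c {x} _.
Arguments cinvK {R M n} c {u} _.
Arguments cmap_cts {R M n} c {x} _.
Arguments cinv_cts {R M n} c {u} _.
Arguments mcover {R n m} x.
Arguments mcompat {R n m} i j.
Arguments mhausdorff {R n} m.
Arguments msecond_countable {R n} m.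
Arguments trans_dom_open {R M n} c d.
Arguments tb_trans_dom_open {R n M} i j.
Arguments tb_dom_open {R n M} i.
Arguments ss_psi {R n M} s _.
Arguments ss_act {R n M} s _ _.
Arguments ss_e {R n M} s i z.

(* Main.v *)
Require Import Defs.
From HB Require Import structures.
From mathcomp Require Import all_boot all_order all_algebra.
From mathcomp Require Import all_classical all_reals all_analysis.
From mathcomp Require Import ring lra.

(** Near any point of [M] the submersion [psi] has a smooth local section [s],
    over an open set [U], so that [Psi (x, a) = s x . a] is a smooth
    equivariant map from [U * O] onto the open set [psi^-1 U]. It is injective
    because [O] acts freely, and its inverse is the sought trivialization; the
    whole difficulty is the smoothness of this inverse.

    The differential of [Psi] is injective. As [psi (Psi (x, a)) = x], a
    vector it kills is tangent to [O], so the question is whether the orbit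
    map [a |-> z . a] is an immersion. Translations of [O] and of [N] show
    that the rank of the orbit map is the same at all points; a map of
    constant rank smaller than the dimension of its source is constant along
    curves, which is excluded since the orbit map is injective
    ([constant_rank_not_injective], [orbit_immersion]).

    The differential of [Psi] is surjective. Otherwise [dim M + dim O < dim N]
    and [Psi] locally maps into slices of smaller dimension, so that it sends
    small compact sets to closed sets with empty interior; since manifolds are
    second countable, countably many of these cover the open set [psi^-1 U],
    against the Baire category theorem ([immersion_onto_open_dim]).

    Hence [Psi] is itself a submersion. Around each point it has a smooth
    local section, which by injectivity coincides with the inverse of [Psi]
    ([local_section], [free_action_principal]).

    All the local statements rest on the inverse function theorem for smooth
    maps of row vectors ([inverse_function]), which is obtained from the
    Banach fixed point theorem. *)

Set Implicit Arguments.
Unset Strict Implicit.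
Unset Printing Implicit Defensive.
Import Order.TTheory GRing.Theory Num.Theory.
Import numFieldNormedType.Exports.
Local Open Scope classical_set_scope.
Local Open Scope ring_scope.

(** * Differential calculus on row vectors *)

(** The Banach and Baire theorems need the norm and the completeness of row
    vectors joined in a single structure. *)
Definition rV_completeNormed (R : realType) (p : nat) :
  completeNormedModType R := HB.pack 'rV[R]_p.

Section Calculus.
Variable R : realType.

Lemma near_is_diffV (V W : normedModType R) (f g : V -> W) (x : V) :
  (\forall y \near x, f y = g y) -> differentiable f x ->
  is_diff x g ('d f x).
Proof.
move=> fg df; have dfc : continuous ('d f x) by exact: diff_continuous.
have e : g \o shift x = cst (g x) + 'd f x +o_ (0 : V) id.
  have /eqaddoP h := diff_locally df.
  apply/eqaddoP => eps eps0; have := h eps eps0.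
  have : \forall y \near (0 : V), f (y + x) = g (y + x).
    by move: fg; rewrite (near_shift 0)/= subr0.
  apply: filterS2 => y e1 h1; rewrite [X in `|X|](_ : _ =
    (f \o shift x - (cst (f x) + 'd f x)) y)//.
  by rewrite -[LHS]/(g (y + x) - (g x + 'd f x y)) -e1 -(nbhs_singleton fg).
have dE := diff_unique dfc e.
apply: DiffDef; last exact: dE.
by apply/diff_locallyP; rewrite dE; split.
Qed.

Lemma near_diffV (V W : normedModType R) (f g : V -> W) (x v : V) :
  (\forall y \near x, f y = g y) -> differentiable f x -> 'd g x v = 'd f x v.
Proof. by move=> fg df; have [_ ->] := near_is_diffV fg df. Qed.

Lemma diff_compE (U V W : normedModType R) (f : U -> V) (g : V -> W) x v :
  differentiable f x -> differentiable g (f x) ->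
  'd (g \o f) x v = 'd g (f x) ('d f x v).
Proof. by move=> df dg; rewrite (congr1 (fun h => h v) (diff_comp df dg)). Qed.

Lemma diff_subE (V W : normedModType R) (f g : V -> W) x v :
  differentiable f x -> differentiable g x ->
  'd (fun y => f y - g y) x v = 'd f x v - 'd g x v.
Proof. by move=> df dg; exact: (congr1 (fun h => h v) (diffB df dg)). Qed.

Lemma diff_addE (V W : normedModType R) (f g : V -> W) x v :
  differentiable f x -> differentiable g x ->
  'd (fun y => f y + g y) x v = 'd f x v + 'd g x v.
Proof. by move=> df dg; exact: (congr1 (fun h => h v) (diffD df dg)). Qed.

Lemma diff_linE (V W : normedModType R) (L : {linear V -> W}) x v :
  continuous L -> 'd L x v = L v.
Proof. by move=> cL; exact: (congr1 (fun h => h v) (diff_lin x cL)). Qed.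

Lemma diff_idE (V : normedModType R) (x v : V) : 'd (@idfun V) x v = v.
Proof. by apply: diff_linE => y; exact: cvg_id. Qed.

(** The values range over any normed module, so that the coefficients of a
    differential, Jacobian matrices and determinants are subject to the same
    calculus as maps between row vectors. *)
Fixpoint CkV (m : nat) (W : normedModType R) (k : nat) (U : set 'rV[R]_m)
    (f : 'rV[R]_m -> W) : Prop :=
  match k with
  | 0 => forall x, U x -> {for x, continuous f}
  | k'.+1 => (forall x, U x -> differentiable f x) /\
             (forall v, CkV k' U (fun x => 'd f x v))
  end.

Lemma CkE (m p k : nat) (U : set 'rV[R]_m) (f : 'rV[R]_m -> 'rV[R]_p) :
  Ck k U f <-> CkV k U f.
Proof.
elim: k f => [|k IH] f //=; split=> -[df dk]; split=> // v; exact/IH/dk.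
Qed.

Section Ck_codomain.
Variables (m : nat) (U : set 'rV[R]_m).
Hypothesis oU : open U.
Implicit Types (V W : normedModType R).

Lemma CkV_eq W k (f g : 'rV[R]_m -> W) :
  (forall x, U x -> f x = g x) -> CkV k U f -> CkV k U g.
Proof.
elim: k f g => [|k IH] f g fg /=.
  move=> cf x Ux; have := cf x Ux; rewrite /prop_for /continuous_at (fg x Ux).
  by apply: cvg_trans; exact: (near_eq_cvg (open_near_eq oU Ux fg)).
case=> df dfk; split=> [x Ux|v].
  by case: (near_is_diffV (open_near_eq oU Ux fg) (df x Ux)).
apply: IH (dfk v) => x Ux.
exact/esym/(near_diffV _ (open_near_eq oU Ux fg) (df x Ux)).
Qed.

Lemma CkV_pred W k (f : 'rV[R]_m -> W) : CkV k.+1 U f -> CkV k U f.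
Proof.
elim: k f => [|k IH] f; first
  by case=> df _ x Ux; apply/differentiable_continuous/df.
by case=> df dfk; split => // v; apply/IH/dfk.
Qed.

Lemma CkV_cst W k (c : W) : CkV k U (fun=> c).
Proof.
elim: k c => [|k IH] c /=.
  by move=> x _; exact: (@cst_continuous _ _ c x).
split=> [x _|v]; first exact: (differentiable_cst c x).
rewrite (_ : (fun x => _) = fun=> 0); first exact: IH.
by apply/funext => x; exact: (congr1 (fun h => h v) (diff_cst c x)).
Qed.

Lemma CkV_add W k (f g : 'rV[R]_m -> W) :
  CkV k U f -> CkV k U g -> CkV k U (fun x => f x + g x).
Proof.
elim: k f g => [|k IH] f g /=.
  move=> cf cg x Ux; exact: (@continuousD _ _ _ f g x (cf x Ux) (cg x Ux)).
case=> df dfk [dg dgk]; split=> [x Ux|v].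
  exact: (differentiableD (df x Ux) (dg x Ux)).
apply: CkV_eq (IH _ _ (dfk v) (dgk v)) => x Ux.
exact: (esym (congr1 (fun h => h v) (diffD (df x Ux) (dg x Ux)))).
Qed.

Lemma CkV_sum W (I : Type) (r : seq I) (P : pred I) k
    (f : I -> 'rV[R]_m -> W) :
  (forall i, CkV k U (f i)) -> CkV k U (fun x => \sum_(i <- r | P i) f i x).
Proof.
move=> fk; elim: r => [|i r IH].
  by rewrite (_ : (fun x => _) = fun=> 0); [exact: CkV_cst|
    apply/funext => x; rewrite big_nil].
apply: (@CkV_eq _ _ (fun x => (if P i then f i x else 0) +
    \sum_(j <- r | P j) f j x)).
  by move=> x _; rewrite big_cons; case: ifP; rewrite ?add0r.
by apply: (CkV_add _ IH); case: (P i); [exact: fk|exact: CkV_cst].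
Qed.

Lemma CkV_linear V W k (L : {linear V -> W}) (f : 'rV[R]_m -> V) :
  continuous L -> CkV k U f -> CkV k U (L \o f).
Proof.
move=> cL; elim: k f => [|k IH] f /=.
  by move=> cf x Ux; exact: (continuous_comp (cf _ Ux) (cL (f x))).
have dL x := linear_differentiable x cL.
case=> df dfk; split=> [x Ux|v].
  exact: (differentiable_comp (df _ Ux) (dL _)).
apply: CkV_eq (IH _ (dfk v)) => x Ux /=.
rewrite (diff_compE v (df x Ux) (dL (f x))).
by rewrite (congr1 (fun h => h _) (diff_lin (f x) cL)).
Qed.

End Ck_codomain.

Lemma scaleV_is_bilinear (W : normedModType R) :
  bilinear_for (GRing.Scale.Law.clone _ _ *:%R _)
    (GRing.Scale.Law.clone _ _ *:%R _) (@GRing.scale R W).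
Proof.
split=> [u'|u] b v w /=; first by rewrite scalerDl -scalerA.
by rewrite scalerDr !scalerA [u * b]mulrC.
Qed.

(** The Leibniz rule, scaling being a continuous bilinear map. *)
Lemma is_diff_scaleV (V W : normedModType R) (a : V -> R) (f : V -> W) x :
  differentiable a x -> differentiable f x ->
  is_diff x (fun y => a y *: f y) (fun v => 'd a x v *: f x + a x *: 'd f x v).
Proof.
move=> da df.
pose B := bilinear_isBilinear.Build R R W W _ _ (@GRing.scale R W)
  (scaleV_is_bilinear W).
pose S : {bilinear R -> W -> W} := HB.pack (@GRing.scale R W) B.
have cS : continuous (fun q : R * W => S q.1 q.2).
  by move=> q; exact: (@scale_continuous R W q).
have dp := differentiable_pair da df.
have dS := @differentiable_bilin _ _ _ _ S (a x, f x) cS.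
apply: DiffDef; first exact: (differentiable_comp dp dS).
apply/funext => v; apply: etrans (diff_compE v dp dS) _ => /=.
rewrite (congr1 (fun h => h _) (@diff_bilin _ _ _ _ S (a x, f x) cS)).
by rewrite (congr1 (fun h => h v) (diff_pair da df)) /= addrC.
Qed.

Lemma CkV_scale m (U : set 'rV[R]_m) (W : normedModType R) k
    (a : 'rV[R]_m -> R) (f : 'rV[R]_m -> W) : open U ->
  CkV k U a -> CkV k U f -> CkV k U (fun x => a x *: f x).
Proof.
move=> oU; elim: k a f => [|k IH] a f.
  move=> ca cf x Ux.
  exact: (@cvgZ R W 'rV[R]_m (nbhs x) _ a f (a x) (f x) (ca x Ux) (cf x Ux)).
move=> ak fk; case: (ak) (fk) => da dak [df dfk]; split=> [x Ux|v].
  by case: (is_diff_scaleV (da x Ux) (df x Ux)).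
apply: (CkV_eq oU _ (CkV_add oU (IH _ _ (dak v) (CkV_pred fk))
  (IH _ _ (CkV_pred ak) (dfk v)))) => x Ux.
have [_ e] := is_diff_scaleV (da x Ux) (df x Ux).
exact: (esym (congr1 (fun h => h v) e)).
Qed.

Lemma CkV_mul m (U : set 'rV[R]_m) k (a b : 'rV[R]_m -> R) : open U ->
  CkV k U a -> CkV k U b -> CkV k U (fun x => a x * b x).
Proof. exact: (@CkV_scale m U R). Qed.

Lemma CkV_prod m (U : set 'rV[R]_m) (I : Type) (r : seq I) k
    (f : I -> 'rV[R]_m -> R) : open U ->
  (forall i, CkV k U (f i)) -> CkV k U (fun x => \prod_(i <- r) f i x).
Proof.
move=> oU fk; elim: r => [|i r IH].
  by rewrite (_ : (fun x => _) = fun=> 1); [exact: CkV_cst|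
    apply/funext => x; rewrite big_nil].
rewrite (_ : (fun x => _) = fun x => f i x * \prod_(j <- r) f j x); last first.
  by apply/funext => x; rewrite big_cons.
exact: CkV_mul.
Qed.

Lemma CkV_inv m (U : set 'rV[R]_m) k (a : 'rV[R]_m -> R) : open U ->
  (forall x, U x -> a x != 0) -> CkV k U a -> CkV k U (fun x => (a x)^-1).
Proof.
move=> oU a0; elim: k => [|k IH] ak.
  by move=> x Ux; apply: continuousV; [exact: a0|exact: ak].
case: (ak) => da dak; split=> [x Ux|v].
  by apply: differentiableV; [exact: da|exact: a0].
have ik := IH (CkV_pred ak).
have E x : U x -> - ((a x)^-1 * (a x)^-1) * 'd a x v =
    'd (fun y => (a y)^-1) x v.
  move=> Ux; have e := diffV (da x Ux) (a0 x Ux).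
  apply: etrans (esym (congr1 (fun h => h v) e)).
  by rewrite -[RHS]/(- (a x)^-2 * 'd a x v) -expr2 exprVn.
apply: (CkV_eq oU E); apply: CkV_mul => //; last exact: dak.
rewrite (_ : (fun x => _) = fun x => -1 * ((a x)^-1 * (a x)^-1)); last first.
  by apply/funext => x; rewrite mulN1r.
by apply: CkV_mul => //; [exact: CkV_cst|exact: CkV_mul].
Qed.

Lemma entry_linear m n (i : 'I_m) (j : 'I_n) :
  exists2 L : {linear 'M[R]_(m, n) -> R}, continuous L &
    forall A, L A = A i j.
Proof.
have lP : linear (fun A : 'M[R]_(m, n) => (A i j : R)).
  by move=> a u v; rewrite !mxE.
pose L : {linear 'M[R]_(m, n) -> R} :=
  HB.pack (fun A : 'M[R]_(m, n) => (A i j : R))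
    (GRing.isLinear.Build _ _ _ _ _ lP).
by exists L => // A; exact: coord_continuous.
Qed.

Lemma CkV_entry p m n (U : set 'rV[R]_p) k (f : 'rV[R]_p -> 'M[R]_(m, n)) i j :
  open U -> CkV k U f -> CkV k U (fun x => f x i j).
Proof.
move=> oU fk; have [L cL LE] := @entry_linear m n i j.
by apply: (CkV_eq oU _ (CkV_linear oU cL fk)) => x _ /=; rewrite LE.
Qed.

Lemma CkV_matrix p m n (U : set 'rV[R]_p) k (f : 'rV[R]_p -> 'M[R]_(m, n)) :
  open U -> (forall i j, CkV k U (fun x => f x i j)) -> CkV k U f.
Proof.
move=> oU fk.
apply: (@CkV_eq _ _ oU _ _
    (fun x => \sum_i \sum_j f x i j *: (delta_mx i j : 'M[R]_(m, n)))).
  by move=> x _; rewrite -matrix_sum_delta.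
apply: (CkV_sum oU) => i; apply: (CkV_sum oU) => j.
exact: (CkV_scale oU (fk i j) (CkV_cst _ _ _)).
Qed.

(** By induction on the order: the partial derivatives of [g], composed with
    [f], occur in the differential of the composite with coefficients taken
    from the differential of [f], and both are of class one less. *)
Lemma CkV_comp m p (U : set 'rV[R]_m) (V : set 'rV[R]_p) (W : normedModType R)
    k (f : 'rV[R]_m -> 'rV[R]_p) (g : 'rV[R]_p -> W) :
  open U -> open V -> (forall x, U x -> V (f x)) ->
  CkV k U f -> CkV k V g -> CkV k U (g \o f).
Proof.
move=> oU oV UV; elim: k g => [|k IH] g.
  by move=> cf cg x Ux; exact: (continuous_comp (cf _ Ux) (cg _ (UV _ Ux))).
move=> fk gk; case: (fk) (gk) => df dfk [dg dgk]; split=> [x Ux|v].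
  exact: (differentiable_comp (df _ Ux) (dg _ (UV _ Ux))).
apply: (@CkV_eq _ _ oU _ _ (fun x =>
    \sum_j ('d f x v) ord0 j *: 'd g (f x) (delta_mx ord0 j))).
  move=> x Ux; rewrite (diff_compE v (df _ Ux) (dg _ (UV _ Ux))).
  rewrite [in RHS](row_sum_delta ('d f x v)) linear_sum.
  by apply: eq_bigr => j _; rewrite linearZ.
apply: (CkV_sum oU) => j; apply: (CkV_scale oU).
  exact: (CkV_entry ord0 j oU (dfk v)).
exact: (IH _ (CkV_pred fk) (dgk (delta_mx ord0 j))).
Qed.

Lemma CkV_det m p (U : set 'rV[R]_m) k (A : 'rV[R]_m -> 'M[R]_p) : open U ->
  (forall i j, CkV k U (fun x => A x i j)) -> CkV k U (fun x => \det (A x)).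
Proof.
move=> oU Ak; rewrite /determinant; apply: (CkV_sum oU) => s.
apply: CkV_mul => //; first exact: CkV_cst.
by apply: (CkV_prod _ oU) => i; exact: Ak.
Qed.

(** By the Cramer rule the inverse is the quotient of a matrix of polynomials
    in the entries by the determinant. *)
Lemma CkV_invmx m p (U : set 'rV[R]_m) k (A : 'rV[R]_m -> 'M[R]_p) : open U ->
  (forall x, U x -> A x \in unitmx) -> CkV k U A ->
  CkV k U (fun x => invmx (A x)).
Proof.
move=> oU Au Ak; have Ae i j := CkV_entry i j oU Ak.
apply: (@CkV_eq _ _ oU _ _ (fun x => (\det (A x))^-1 *: \adj (A x))).
  by move=> x Ux; rewrite /invmx (Au x Ux).
apply: (CkV_scale oU).
  apply: (CkV_inv oU); last exact: CkV_det.
  by move=> x Ux; have := Au x Ux; rewrite unitmxE unitfE.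
apply: (CkV_matrix oU) => i j.
rewrite (_ : (fun x => _) = (fun x => (-1) ^+ (j + i) *:
    \det (row' j (col' i (A x))))); last first.
  by apply/funext => x; rewrite mxE.
apply: CkV_mul => //; first exact: CkV_cst.
apply: (CkV_det oU) => a b; rewrite (_ : (fun x => _) =
  fun x => A x (lift j a) (lift i b)) //.
by apply/funext => x; rewrite !mxE.
Qed.

End Calculus.

(** * The mean value inequality *)

Section MeanValue.
Variable R : realType.

Lemma coord_le_norm p (v : 'rV[R]_p) j : `|v ord0 j| <= `|v|.
Proof.
rewrite [leRHS]/Num.norm /= mx_normrE; apply/bigmax_geP; right => /=.
by exists (ord0, j).
Qed.

Lemma rV_norm_le p (v : 'rV[R]_p) c :
  0 <= c -> (forall j, `|v ord0 j| <= c) -> `|v| <= c.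
Proof.
move=> c0 h; rewrite [leLHS]/Num.norm /= mx_normrE; apply/bigmax_leP; split=> //.
by move=> [i j] _ /=; rewrite ord1; exact: h.
Qed.

Lemma is_derive_line m p (f : 'rV[R]_m -> 'rV[R]_p) (y w : 'rV[R]_m)
    (t : R) j :
  differentiable f (y + t *: w) ->
  is_derive t 1 (fun s => f (y + s *: w) ord0 j) ('d f (y + t *: w) w ord0 j).
Proof.
move=> df; have [L cL LE] := @entry_linear R 1 p ord0 j.
pose l := fun s : R => y + s *: w.
have dl : is_diff t l (fun s => s *: w).
  have h1 := is_diff_cst y t; have h2 := is_diff_scalel t w.
  have h := is_diffD h1 h2.
  by apply: (is_diff_eq h); rewrite add0r.
have [dl1 dl2] := dl.
have dfl := differentiable_comp dl1 df.
have dL x := linear_differentiable x cL.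
have dLfl := differentiable_comp dfl (dL _).
rewrite (_ : (fun s => _) = L \o (f \o l)); last first.
  by apply/funext => s /=; rewrite LE.
apply: DeriveDef; first exact: diff_derivable.
rewrite deriveE //.
rewrite (diff_compE _ dfl (dL _)) (congr1 (fun h => h _) (diff_lin _ cL)) LE.
by rewrite (diff_compE _ dl1 df) dl2 scale1r.
Qed.

(** The norm of a row vector is the largest absolute value of its coordinates,
    so that the real mean value theorem may be applied to each coordinate,
    with an intermediate point depending on it. *)
Lemma mean_value_le m p (f : 'rV[R]_m -> 'rV[R]_p) (x y : 'rV[R]_m)
    (c : R) : 0 <= c ->
  (forall t : R, 0 <= t <= 1 -> differentiable f (y + t *: (x - y)) /\
    `|'d f (y + t *: (x - y)) (x - y)| <= c) ->
  `|f x - f y| <= c.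
Proof.
move=> c0 h; apply: rV_norm_le => // j.
pose F (t : R) : R := f (y + t *: (x - y)) ord0 j.
pose dF (t : R) : R := 'd f (y + t *: (x - y)) (x - y) ord0 j.
have dFE (t : R) : t \in `[0, 1]%R -> is_derive t 1 F (dF t).
  by rewrite in_itv /= => /h [df _]; exact: is_derive_line.
have cF : {within `[0, 1], continuous F}.
  apply: derivable_within_continuous => t t01.
  by have [] := dFE t t01.
have dFo (t : R) : t \in `]0, 1[%R -> is_derive t 1 F (dF t).
  by move=> t01; apply: dFE; apply: subset_itv_oo_cc.
have [t t01] := MVT (@ltr01 R) dFo cF.
rewrite subr0 mulr1 /F scale1r scale0r addr0 [y + _]addrC subrK => E.
rewrite !mxE E; apply: le_trans (coord_le_norm _ _) _.
move: (subset_itv_oo_cc t01); rewrite in_itv /= => /h[_].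
exact.
Qed.

End MeanValue.

(** * The inverse function theorem, normalized at the identity *)

Section InverseFunction.
Variable R : realType.

Lemma diff_rowE m p (f : 'rV[R]_m -> 'rV[R]_p) (x v : 'rV[R]_m) :
  'd f x v = \sum_i v ord0 i *: 'd f x (delta_mx ord0 i).
Proof.
rewrite [in LHS](row_sum_delta v) linear_sum.
by apply: eq_bigr => i _; rewrite linearZ.
Qed.

(** For a map of class C^1 the differential varies continuously in operator
    norm, since it is determined by the images of finitely many basis vectors. *)
Lemma diff_near_id p (U : set 'rV[R]_p) (f : 'rV[R]_p -> 'rV[R]_p) a :
  open U -> U a -> CkV 1 U f -> (forall v, 'd f a v = v) ->
  exists2 r : R, 0 < r & forall x, `|x - a| <= r ->
    U x /\ forall v, `|v - 'd f x v| <= 2^-1 * `|v|.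
Proof.
move=> oU Ua [df dfc] dfa.
(* each of the [p] coordinates of [v] contributes at most [eps * `|v|] *)
pose eps : R := (2 * p.+1%:R)^-1.
have eps0 : 0 < eps by rewrite invr_gt0 mulr_gt0.
have near_e : \forall x \near a, forall i : 'I_p,
    `|'d f a (delta_mx ord0 i) - 'd f x (delta_mx ord0 i)| < eps.
  apply: (@filter_forall _ 'I_p (fun i => [set x |
    `|'d f a (delta_mx ord0 i) - 'd f x (delta_mx ord0 i)| < eps]) (nbhs a) _) => i.
  by have /cvgrPdist_lt /(_ _ eps0) := dfc (delta_mx ord0 i) a Ua.
have nU : nbhs a U by exact: open_nbhs_nbhs.
have : nbhs a (U `&` [set x | forall i : 'I_p,
    `|'d f a (delta_mx ord0 i) - 'd f x (delta_mx ord0 i)| < eps]).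
  exact: filterI.
case/nbhs_ballP => e /= e0 he.
exists (e / 2); first by rewrite divr_gt0.
move=> x xa; have /he[Ux hx] : ball a e x.
  rewrite -ball_normE /= distrC; apply: le_lt_trans xa _.
  by rewrite ltr_pdivrMr// ltr_pMr// ltr1n.
split; first exact: Ux.
move=> v.
have -> : v - 'd f x v = \sum_i v ord0 i *:
    ('d f a (delta_mx ord0 i) - 'd f x (delta_mx ord0 i)).
  transitivity ('d f a v - 'd f x v); first by congr (_ - _); rewrite dfa.
  apply: etrans (congr2 (fun u w => u - w) (diff_rowE f a v)
    (diff_rowE f x v)) _.
  rewrite -sumrB.
  apply: eq_bigr => i _.
  by rewrite scalerBr.
apply: le_trans (ler_norm_sum _ _ _) _.
apply: (@le_trans _ _ (\sum_(i < p) `|v| * eps)).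
  apply: ler_sum => i _; rewrite normrZ.
  by apply: ler_pM => //; [exact: coord_le_norm|exact: ltW].
rewrite sumr_const card_ord -[leLHS]mulr_natr -mulrA mulrC ler_wpM2r//.
rewrite /eps invfM -mulrA ler_piMr// ler_pdivrMl// mulr1 ler_nat.
exact: leqnSn.
Qed.

(** The bound says that [x |-> x - f x] has differential of norm at most 1/2
    on a ball, which is convex. *)
Lemma id_perturbation_lipschitz p (f : 'rV[R]_p -> 'rV[R]_p) a (r : R) x y :
  (forall z, `|z - a| <= r -> differentiable f z /\
    forall v, `|v - 'd f z v| <= 2^-1 * `|v|) ->
  `|x - a| <= r -> `|y - a| <= r ->
  `|(x - f x) - (y - f y)| <= 2^-1 * `|x - y|.
Proof.
move=> h xa ya.
have cid : continuous (idfun : 'rV[R]_p -> 'rV[R]_p) by move=> z; exact: cvg_id.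
apply: (@mean_value_le R p p (fun z => z - f z) x y).
  by rewrite mulr_ge0 ?invr_ge0.
move=> t /andP[t0 t1]; set z := y + t *: (x - y).
have za : `|z - a| <= r.
  have -> : z - a = (1 - t) *: (y - a) + t *: (x - a).
    rewrite /z; apply/rowP => j; rewrite !mxE; ring.
  apply: le_trans (ler_normD _ _) _; rewrite !normrZ.
  rewrite (ger0_norm t0) ger0_norm; last lra.
  have h1 : (1 - t) * `|y - a| <= (1 - t) * r by apply: ler_wpM2l => //; lra.
  have h2 : t * `|x - a| <= t * r by apply: ler_wpM2l.
  by rewrite (le_trans (lerD h1 h2))//; lra.
have [df hv] := h z za.
have did := linear_differentiable z cid.
split; first exact: (differentiableB did df).
have -> : 'd (fun z => z - f z) z (x - y) = (x - y) - 'd f z (x - y).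
  by apply: etrans (diff_subE _ did df) _; congr (_ - _); exact: diff_idE.
exact: hv.
Qed.

(** A solution of [f x = y] is a fixed point of [x |-> x - f x + y], which is
    a contraction of the closed ball into its interior. *)
Lemma id_perturbation_surj p (f : 'rV[R]_p -> 'rV[R]_p) (a : 'rV[R]_p) (r : R)
    (y : 'rV[R]_p) : 0 < r ->
  (forall x x' : 'rV[R]_p, `|x - a| <= r -> `|x' - a| <= r ->
    `|(x - f x) - (x' - f x')| <= 2^-1 * `|x - x'|) ->
  `|y - f a| < r / 2 -> exists2 x, `|x - a| < r & f x = y.
Proof.
move=> r0 lip ya.
pose D := [set x | `|x - a| <= r].
pose T := fun x => (x - f x) + y.
(* half of [r] comes from the contraction, the other half from [y] *)
have Ta x : D x -> `|T x - a| < r.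
  move=> Dx; have -> : T x - a = ((x - f x) - (a - f a)) + (y - f a).
    by rewrite /T; apply/rowP => j; rewrite !mxE; ring.
  apply: le_lt_trans (ler_normD _ _) _.
  have aa : `|a - a| <= r by rewrite subrr normr0 ltW.
  have h1 := lip x a Dx aa.
  have h2 : 2^-1 * `|x - a| <= 2^-1 * r by apply: ler_wpM2l.
  lra.
have TD : set_fun D D T by move=> x Dx; apply/ltW/Ta.
pose Tf : {fun D >-> D} := HB.pack T (isFun.Build _ _ _ _ _ TD).
have half : 0 <= (2^-1 : R) by [].
have ctr : is_contraction Tf.
  exists (NngNum half); split; first by rewrite /= invf_lt1// ltr1n.
  move=> [u v] [/= Du Dv]; suff : `|T u - T v| <= 2^-1 * `|u - v| by [].
  rewrite /T.
  have -> : u - f u + y - (v - f v + y) = (u - f u) - (v - f v).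
    by rewrite opprD addrACA subrr addr0.
  exact: lip.
have cD : closed D.
  have -> : D = closed_ball_ (fun x => `|x|) a r.
    by apply/seteqP; split=> x; rewrite /D /closed_ball_ /= distrC.
  exact: closed_closed_ball_.
have D0 : D !=set0 by exists a; rewrite /D /= subrr normr0 ltW.
have [x Dx xT] := @banach_fixed_point R (rV_completeNormed R p) D Tf ctr cD D0.
have E : x = x - f x + y := xT.
exists x; first by have := Ta x Dx; rewrite /T -E.
apply/esym/eqP; rewrite -subr_eq0.
have -> : y - f x = x - f x + y - x by apply/rowP => j; rewrite !mxE; ring.
by rewrite -E subrr.
Qed.

Lemma CkV_jacobian m p (U : set 'rV[R]_m) k (f : 'rV[R]_m -> 'rV[R]_p) :
  open U -> CkV k.+1 U f -> CkV k U (fun x => lin1_mx ('d f x)).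
Proof.
move=> oU [_ dfk]; apply: (CkV_matrix oU) => i j.
apply: (CkV_eq oU _ (CkV_entry ord0 j oU (dfk (delta_mx ord0 i)))) => x _.
by rewrite mxE.
Qed.

Lemma mul_rV_mulmx_linear m p (A : 'M[R]_(m, p)) :
  exists2 L : {linear 'rV[R]_m -> 'rV[R]_p}, continuous L &
    forall v, L v = v *m A.
Proof. by exists (mulmxr A) => // x; exact: linear_rV_cts. Qed.

(** Being Lipschitz at [y], the inverse [g] turns the remainder of the
    expansion of [f] at [g y], which is small with respect to [g y' - g y],
    into one that is small with respect to [y' - y]. *)
Lemma inverse_differentiable p (f g : 'rV[R]_p -> 'rV[R]_p) (W : set 'rV[R]_p)
    y (c : R) : open W -> W y -> 0 < c ->
  (forall y', W y' -> f (g y') = y' /\ `|g y' - g y| <= c * `|y' - y|) ->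
  differentiable f (g y) -> lin1_mx ('d f (g y)) \in unitmx ->
  is_diff y g (fun v => v *m invmx (lin1_mx ('d f (g y)))).
Proof.
move=> oW Wy c0 hg df Au; set A := lin1_mx _ in Au *; set x := g y in df A Au *.
have [L cL LE] := mul_rV_mulmx_linear (invmx A).
have [C C0 hC] := linear_lipschitz cL.
have e : g \o shift y = cst (g y) + L +o_ (0 : 'rV[R]_p) id.
  apply/eqaddoP => eps eps0.
  have eps'0 : 0 < eps / (c * C) by rewrite divr_gt0 ?mulr_gt0.
  have /eqaddoP/(_ _ eps'0) h := diff_locally df.
  case/nbhs_ballP: h => d /= d0 hd.
  have nW : \forall h \near (0 : 'rV[R]_p), W (h + y).
    have : \forall z \near y, W z by exact: open_nbhs_nbhs.
    by rewrite (near_shift 0) /= subr0.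
  have nd : \forall h \near (0 : 'rV[R]_p), `|h| < d / c.
    apply/nbhs_ballP; exists (d / c) => /=; first by rewrite divr_gt0.
    by move=> h; rewrite -ball_normE /= sub0r normrN.
  apply: filterS2 nW nd => h Wh hd'.
  have [fgh gh] := hg _ Wh; have [fgy _] := hg _ Wy.
  set k := g (h + y) - g y; move: gh; rewrite addrK -/k => gh.
  have /hd : ball 0 d k.
    rewrite -ball_normE /= sub0r normrN; apply: le_lt_trans gh _.
    by rewrite mulrC -ltr_pdivlMr.
  have -> : (f \o shift x - (cst (f x) + 'd f x)) k = h - k *m A.
    rewrite -[LHS]/(f (k + x) - (f x + 'd f x k)).
    by rewrite /k subrK fgh fgy opprD addrA addrK mul_rV_lin1.
  move=> hk.
  have -> : (g \o shift y - (cst (g y) + L)) h = L (k *m A - h).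
    rewrite -[LHS]/(g (h + y) - (g y + L h)) linearB /= !LE.
    by rewrite mulmxK// opprD addrA.
  apply: le_trans (hC _) _; rewrite distrC -[leRHS]/(eps * `|h|).
  apply: le_trans (ler_wpM2l (ltW C0) hk) _.
  rewrite -[leLHS]/(C * (eps / (c * C) * `|k|)).
  apply: le_trans (ler_wpM2l (ltW C0) (ler_wpM2l (ltW eps'0) gh)) _.
  rewrite le_eqVlt; apply/orP; left; apply/eqP; field.
  by rewrite !gt_eqF.
have dE := diff_unique cL e.
apply: DiffDef; last by rewrite dE; apply/funext => v; rewrite LE.
by apply/diff_locallyP; rewrite dE; split.
Qed.

(** The differential of [g] at [y] is the inverse of that of [f] at [g y];
    since [g] occurs there undifferentiated, each order of regularity yields
    the next. *)
Lemma CkV_inverse p (f g : 'rV[R]_p -> 'rV[R]_p) (U W : set 'rV[R]_p) :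
  open U -> open W -> (forall k, CkV k U f) -> (forall y, W y -> U (g y)) ->
  (forall x, U x -> lin1_mx ('d f x) \in unitmx) ->
  (forall y, W y -> is_diff y g
    (fun v => v *m invmx (lin1_mx ('d f (g y))))) ->
  forall k, CkV k W g.
Proof.
move=> oU oW fk gU Au dg; elim=> [|k IH].
  by move=> y Wy; apply: differentiable_continuous; case: (dg y Wy).
split=> [y Wy|v]; first by case: (dg y Wy).
have Ak := CkV_invmx oW _ (CkV_comp oW oU gU IH (CkV_jacobian oU (fk k.+1))).
apply: (@CkV_eq _ _ _ oW _ _
    (fun y => v *m invmx (lin1_mx ('d f (g y))))).
  by move=> y Wy; have [_ e] := dg y Wy; exact: (esym (congr1 (fun h => h v) e)).
apply: (CkV_matrix oW) => i j.
rewrite (_ : (fun y => _) = fun y => \sum_l v i l *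
    invmx (lin1_mx ('d f (g y))) l j); last first.
  by apply/funext => y; rewrite mxE.
apply: (CkV_sum oW) => l; apply: CkV_mul => //; first exact: CkV_cst.
by apply: (CkV_entry l j oW); apply: Ak => y Wy /=; exact/Au/gU.
Qed.

Lemma inverse_function_id p (U : set 'rV[R]_p) (f : 'rV[R]_p -> 'rV[R]_p) a :
  open U -> U a -> (forall k, CkV k U f) -> (forall v, 'd f a v = v) ->
  exists (V W : set 'rV[R]_p) (g : 'rV[R]_p -> 'rV[R]_p),
    [/\ open V /\ open W, V a, V `<=` U, forall k, CkV k W g &
      (forall x, V x -> W (f x) /\ g (f x) = x) /\
      (forall y, W y -> V (g y) /\ f (g y) = y)].
Proof.
move=> oU Ua fk dfa.
have [r r0 hr] := diff_near_id oU Ua (fk 1%N) dfa.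
have [df _] := fk 1%N.
have lip x x' : `|x - a| <= r -> `|x' - a| <= r ->
    `|(x - f x) - (x' - f x')| <= 2^-1 * `|x - x'|.
  move=> xa x'a; apply: id_perturbation_lipschitz xa x'a => z /hr[Uz hz].
  by split=> //; exact: df.
have inj x x' : `|x - a| <= r -> `|x' - a| <= r ->
    `|x - x'| <= 2 * `|f x - f x'|.
  move=> xa x'a; have h := lip x x' xa x'a.
  have : `|x - x'| <= `|(x - f x) - (x' - f x')| + `|f x - f x'|.
    apply: le_trans (ler_normD _ _); rewrite le_eqVlt; apply/orP; left.
    by apply/eqP; congr `|_|; apply/rowP => j; rewrite !mxE; ring.
  lra.
pose W : set 'rV[R]_p := ball (f a) (r / 2).
pose B : set 'rV[R]_p := ball a r.
have BE x : B x <-> `|x - a| < r by rewrite /B -ball_normE /= distrC.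
have WE y : W y <-> `|y - f a| < r / 2 by rewrite /W -ball_normE /= distrC.
have oW : open W by exact: ball_open.
have oB : open B by exact: ball_open.
have BU x : B x -> U x by move=> /BE/ltW/hr[].
have /choice[g hg] (y : 'rV[R]_p) :
    exists x : 'rV[R]_p, W y -> B x /\ f x = y.
  have [/WE Wy|] := pselect (W y); last by exists 0.
  have [x xa fx] := id_perturbation_surj r0 lip Wy.
  by exists x => _; split=> //; exact/BE.
have unit x : B x -> lin1_mx ('d f x) \in unitmx.
  move=> /BE/ltW/hr[_ hx]; rewrite -row_free_unit; apply: inj_row_free => v.
  rewrite mul_rV_lin1 => v0; have := hx v; rewrite v0 subr0 => h.
  have : `|v| <= 0 by lra.
  by rewrite normr_le0 => /eqP.
have dg y : W y -> is_diff y g (fun v => v *m invmx (lin1_mx ('d f (g y)))).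
  move=> Wy; have [By _] := hg y Wy.
  apply: (@inverse_differentiable _ f g W y 2 oW Wy) => //; last 2 first.
  - exact/df/BU.
  - exact: unit.
  move=> y' Wy'; have [By' fy'] := hg y' Wy'; split=> //.
  have [_ fy] := hg y Wy.
  by rewrite -{2}fy -{2}fy'; apply: inj; exact/ltW/BE.
have cf x : B x -> {for x, continuous f}.
  by move=> Bx; exact: (fk 0%N x (BU x Bx)).
exists (B `&` f @^-1` W), W, g; split.
- by split; [exact: (open_pre oB cf oW)|].
- by split; [apply/BE|apply/WE]; rewrite subrr normr0 ?divr_gt0.
- by move=> x [/BU].
- apply: (@CkV_inverse _ f g B W) => //.
    by move=> k; apply/CkE; apply: (Ck_sub BU); apply/CkE.
  by move=> y /hg[].
- split=> [x [Bx Wfx]|y Wy].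
    have [Bg fg] := hg _ Wfx; split=> //.
    apply/eqP; rewrite -subr_eq0 -normr_le0.
    have /BE/ltW h1 := Bg; have /BE/ltW h2 := Bx.
    by have := inj _ _ h1 h2; rewrite fg subrr normr0 mulr0.
  have [Bg fg] := hg y Wy; split=> //; split=> //=.
  by rewrite fg.
Qed.

End InverseFunction.

(** * Local inverses and local right inverses *)

Section LocalForms.
Variable R : realType.

Lemma CinfE m p (U : set 'rV[R]_m) (f : 'rV[R]_m -> 'rV[R]_p) :
  Cinf U f <-> forall k, CkV k U f.
Proof. by split=> h k; [apply/CkE; exact: h|apply/CkE; exact: h]. Qed.

Lemma Cinf_differentiable m p (U : set 'rV[R]_m) (f : 'rV[R]_m -> 'rV[R]_p) x :
  Cinf U f -> U x -> differentiable f x.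
Proof. by move=> /(_ 1%N)[df _]; exact: df. Qed.

Lemma Cinf_continuous m p (U : set 'rV[R]_m) (f : 'rV[R]_m -> 'rV[R]_p) x :
  Cinf U f -> U x -> {for x, continuous f}.
Proof. by move=> /(_ 0%N) cf; exact: cf. Qed.

Lemma Cinf_subset m p (U V : set 'rV[R]_m) (f : 'rV[R]_m -> 'rV[R]_p) :
  V `<=` U -> Cinf U f -> Cinf V f.
Proof. by move=> VU fk k; exact: (Ck_sub VU (fk k)). Qed.

Lemma Cinf_eq m p (U : set 'rV[R]_m) (f g : 'rV[R]_m -> 'rV[R]_p) :
  open U -> (forall x, U x -> f x = g x) -> Cinf U f -> Cinf U g.
Proof. by move=> oU fg fk k; exact: (Ck_eq oU fg (fk k)). Qed.

Lemma Cinf_comp m p q (U : set 'rV[R]_m) (V : set 'rV[R]_p)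
    (f : 'rV[R]_m -> 'rV[R]_p) (g : 'rV[R]_p -> 'rV[R]_q) :
  open U -> open V -> (forall x, U x -> V (f x)) ->
  Cinf U f -> Cinf V g -> Cinf U (g \o f).
Proof.
move=> oU oV UV /CinfE fk /CinfE gk; apply/CinfE => k.
exact: (CkV_comp oU oV UV (fk k) (gk k)).
Qed.

Lemma mulmxr_continuous p q (P : 'M[R]_(p, q)) :
  continuous (mulmxr P : 'rV[R]_p -> 'rV[R]_q).
Proof. exact: (@linear_rV_cts R p q (mulmxr P)). Qed.

Lemma affine_Cinf p q (b : 'rV[R]_q) (P : 'M[R]_(p, q)) :
  Cinf setT (fun y : 'rV[R]_p => b + y *m P).
Proof.
move=> k; apply: (Ck_add openT (Ck_cst _ _ _)).
by have := Ck_linl (@mulmxr_continuous p q P) openT (Ck_id k setT).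
Qed.

Lemma affine_continuous p q (b : 'rV[R]_q) (P : 'M[R]_(p, q)) :
  continuous (fun y : 'rV[R]_p => b + y *m P).
Proof. by move=> y; exact: (affine_Cinf b P 0%N y I). Qed.

Lemma affine_diffE p q (b : 'rV[R]_q) (P : 'M[R]_(p, q)) x v :
  'd (fun y : 'rV[R]_p => b + y *m P) x v = v *m P.
Proof.
have cP := @mulmxr_continuous p q P.
have h := diff_addE v (differentiable_cst b x)
  (linear_differentiable x cP).
apply: etrans h _; rewrite -[RHS]add0r; congr (_ + _).
  exact: (congr1 (fun h => h v) (diff_cst b x)).
exact: diff_linE.
Qed.

Section Twist.
Variables (m p q s : nat) (U : set 'rV[R]_m) (f : 'rV[R]_m -> 'rV[R]_p).
Variables (b : 'rV[R]_m) (P : 'M[R]_(q, m)) (B : 'M[R]_(p, s)).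
Variable Q : 'M[R]_(q, s).
Hypotheses (oU : open U) (fk : Cinf U f).

(** The inverse function theorem is applied below to [f] after an affine
    change of the source and a linear change of the target, with a linear
    correction that makes the differential invertible. *)
Definition twist (y : 'rV[R]_q) : 'rV[R]_s := f (b + y *m P) *m B + y *m Q.
Definition twist_dom : set 'rV[R]_q :=
  (fun y => b + y *m P) @^-1` U.

Lemma twist_dom_open : open twist_dom.
Proof.
by apply: open_comp => // y _; exact: affine_continuous.
Qed.

Lemma twist_Cinf : Cinf twist_dom twist.
Proof.
have fa : Cinf twist_dom (f \o (fun y => b + y *m P)).
  apply: (Cinf_comp twist_dom_open oU _ _ fk) => //.
  exact: (Cinf_subset _ (affine_Cinf b P)).
move=> k; apply: (Ck_add twist_dom_open).
  exact: (Ck_linl (@mulmxr_continuous p s B) twist_dom_open (fa k)).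
exact: (Ck_linl (@mulmxr_continuous q s Q) twist_dom_open (Ck_id k _)).
Qed.

Lemma twist_diffE y v : twist_dom y ->
  'd twist y v = 'd f (b + y *m P) (v *m P) *m B + v *m Q.
Proof.
move=> Uy; have da : differentiable (fun y => b + y *m P) y.
  exact: (Cinf_differentiable (affine_Cinf b P)).
have df : differentiable f (b + y *m P) by exact: (Cinf_differentiable fk).
have dfa := differentiable_comp da df.
have cB := @mulmxr_continuous p s B; have cQ := @mulmxr_continuous q s Q.
have dB := linear_differentiable ((f \o (fun y => b + y *m P)) y) cB.
have dQ := linear_differentiable y cQ.
apply: etrans (diff_addE v (differentiable_comp dfa dB) dQ) _.
congr (_ + _); last exact: diff_linE.
apply: etrans (diff_compE v dfa dB) _; apply: etrans (diff_linE _ _ cB) _.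
congr (_ *m _); apply: etrans (diff_compE v da df) _.
by congr ('d f _ _); exact: affine_diffE.
Qed.
End Twist.

(** The inverse of the Jacobian matrix at [a] reduces this to a differential
    equal to the identity. *)
Lemma inverse_function p (U : set 'rV[R]_p) (f : 'rV[R]_p -> 'rV[R]_p) a :
  open U -> U a -> Cinf U f -> (forall v, 'd f a v = 0 -> v = 0) ->
  exists (V W : set 'rV[R]_p) (g : 'rV[R]_p -> 'rV[R]_p),
    [/\ open V /\ open W, V a, V `<=` U, Cinf W g &
      (forall x, V x -> W (f x) /\ g (f x) = x) /\
      (forall y, W y -> V (g y) /\ f (g y) = y)].
Proof.
move=> oU Ua fk inj; set A := lin1_mx ('d f a).
have Au : A \in unitmx.
  by rewrite -row_free_unit; apply: inj_row_free => v; rewrite mul_rV_lin1 => /inj.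
pose B := invmx A.
pose f1 := twist f 0 1%:M B 0.
have aE (x : 'rV[R]_p) : 0 + x *m 1%:M = x by rewrite add0r mulmx1.
have f1E x : f1 x = f x *m B by rewrite /f1 /twist aE mulmx0 addr0.
have DE : twist_dom U 0 1%:M = U.
  by apply/seteqP; split=> x; rewrite /twist_dom /= aE.
have f1k : Cinf U f1 by rewrite -DE; exact: twist_Cinf.
have df1 v : 'd f1 a v = v.
  have Da : twist_dom U 0 1%:M a by rewrite DE.
  apply: etrans (twist_diffE _ _ fk v Da) _.
  by rewrite aE !mulmx1 mulmx0 addr0 -mul_rV_lin1 mulmxK.
have [V [W [g [[oV oW] Va VU /CinfE gk [h1 h2]]]]] :=
  inverse_function_id oU Ua ((CinfE _ _).1 f1k) df1.
have cB := @mulmxr_continuous p p B.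
exists V, [set y | W (y *m B)], (fun y => g (y *m B)); split=> //.
- split=> //; by apply: (@open_comp _ _ (mulmxr B) W) => // x _; exact: cB.
- by move=> k; exact: (Ck_linr cB oW (gk k)).
split=> [x /h1[]|y /= /h2[Vg]]; first by rewrite /= f1E.
split=> //; move: b; rewrite f1E.
by move/(congr1 (mulmx^~ A)); rewrite -!mulmxA mulVmx// !mulmx1.
Qed.

(** If the rows of [B] are preimages of the basis vectors by the differential
    of [f] at [a], then [y |-> f (a + y *m B)] has the identity as
    differential at 0, and it is enough to invert it. *)
Lemma local_right_inverse m n (U : set 'rV[R]_m) (f : 'rV[R]_m -> 'rV[R]_n) a :
  open U -> U a -> Cinf U f -> (forall w, exists v, 'd f a v = w) ->
  exists (W : set 'rV[R]_n) (s : 'rV[R]_n -> 'rV[R]_m),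
    [/\ open W, W (f a), s (f a) = a, Cinf W s &
      forall y, W y -> U (s y) /\ f (s y) = y].
Proof.
move=> oU Ua fk surj.
have /choice[b hb] (i : 'I_n) : exists v, 'd f a v = delta_mx ord0 i.
  exact: surj.
pose B := \matrix_i b i.
have BE w : 'd f a (w *m B) = w.
  rewrite mulmx_sum_row linear_sum [RHS]row_sum_delta.
  by apply: eq_bigr => i _; rewrite linearZ /= rowK hb.
pose h := twist f a B 1%:M 0.
have hE y : h y = f (a + y *m B) by rewrite /h /twist mulmx0 addr0 mulmx1.
have aE : a + 0 *m B = a by rewrite mul0mx addr0.
have D0 : twist_dom U a B 0 by rewrite /twist_dom /= aE.
have oD : open (twist_dom U a B) := twist_dom_open oU.
have [V [W [g [[oV oW] V0 VD gk [h1 h2]]]]] : exists (V W : set 'rV[R]_n)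
    (g : 'rV[R]_n -> 'rV[R]_n),
    [/\ open V /\ open W, V 0, V `<=` twist_dom U a B, Cinf W g &
      (forall x, V x -> W (h x) /\ g (h x) = x) /\
      (forall y, W y -> V (g y) /\ h (g y) = y)].
  apply: (inverse_function oD D0 (twist_Cinf _ _ _ _ oU fk)) => v.
  rewrite (_ : 'd h 0 v = v) //; apply: etrans (twist_diffE _ _ fk v D0) _.
  by rewrite aE mulmx0 addr0 mulmx1 BE.
have h0 : h 0 = f a by rewrite hE aE.
exists W, (fun y => a + g y *m B); split=> //.
- by have [] := h1 _ V0; rewrite h0.
- by have [_] := h1 _ V0; rewrite h0 => ->; rewrite aE.
- exact: (Cinf_comp oW openT _ gk (affine_Cinf a B)).
- by move=> y /h2[/VD Ug]; rewrite hE.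
Qed.

End LocalForms.

(** * Immersions and maps of constant rank *)

Section RankForms.
Variable R : realType.

Lemma line_meets_nbhs m (N : set 'rV[R]_m) (y w : 'rV[R]_m) : nbhs y N ->
  exists2 t : R, 0 < t & forall s : R, 0 <= s <= t -> N (y + s *: w).
Proof.
move=> nN; have c : {for (0 : R), continuous (fun t : R => y + t *: w)}.
  apply: (@continuousD _ _ _ (cst y) (fun t : R => t *: w)).
    exact: cst_continuous.
  exact: scalel_continuous.
have : nbhs (0 : R) ((fun t : R => y + t *: w) @^-1` N).
  by apply: c; rewrite scale0r addr0.
case/nbhs_ballP => e /= e0 he; exists (e / 2); first by rewrite divr_gt0.
move=> s /andP[s0 se]; apply: (he s).
by rewrite /ball /= sub0r normrN ger0_norm//; lra.
Qed.

Lemma delta_mx_pid m n (i : 'I_m) r : (r <= i)%N ->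
  (delta_mx ord0 i : 'rV[R]_m) *m (pid_mx r : 'M[R]_(m, n)) = 0.
Proof.
move=> ri; rewrite -rowE; apply/rowP => j; rewrite !mxE.
by rewrite [X in _ && X]ltnNge ri andbF.
Qed.

(** Adding the missing directions, [f] becomes the restriction to a
    [p]-dimensional slice of a map [h] of the whole space which is injective
    near the point of the slice given by [a]. If the image of [f] were a
    neighbourhood of one of its points, then moving that point slightly off
    the slice would not leave the image, and [h] would take the same value on
    and off the slice. *)
Lemma immersion_image_interior p m (U : set 'rV[R]_p)
    (f : 'rV[R]_p -> 'rV[R]_m) a :
  (p < m)%N -> open U -> U a -> Cinf U f -> (forall v, 'd f a v = 0 -> v = 0) ->
  exists2 V : set 'rV[R]_p, [/\ open V, V a & V `<=` U] &
    forall O : set 'rV[R]_m, open O -> O `<=` f @` V -> O = set0.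
Proof.
move=> pm oU Ua fk inj; have pm' := ltnW pm; set A := lin1_mx ('d f a).
have Af : row_free A.
  by apply: inj_row_free => v; rewrite mul_rV_lin1 => /inj.
have rA : \rank A = p by exact/eqP.
set E := row_ebase A; set C := col_ebase A.
have Eu : E \in unitmx by exact: row_ebase_unit.
have Cu : C \in unitmx by exact: col_ebase_unit.
have AE : A = C *m pid_mx p *m E.
  by have := mulmx_ebase A; rewrite [X in pid_mx X]rA => ->.
pose i : 'M[R]_(p, m) := pid_mx p; pose P : 'M[R]_(m, p) := pid_mx p.
have iP : i *m P = 1%:M by rewrite pid_mx_id// pid_mx_1.
pose Q := copid_mx p *m E.
pose h := twist f 0 P 1%:M Q.
have hE x u : h (x *m i + u) = f (x + u *m P) + u *m Q.
  rewrite /h /twist add0r mulmx1 mulmxDl -mulmxA iP mulmx1.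
  congr (_ + _); rewrite mulmxDl /Q !mulmxA -[x *m i *m _]mulmxA.
  by rewrite mul_pid_mx_copid// mulmx0 mul0mx add0r.
have D0 : twist_dom U 0 P (a *m i).
  by rewrite /twist_dom /= add0r -mulmxA iP mulmx1.
have oD : open (twist_dom U 0 P) := twist_dom_open oU.
have hk : Cinf (twist_dom U 0 P) h by exact: twist_Cinf.
have hinj v : 'd h (a *m i) v = 0 -> v = 0.
  move=> /(etrans (esym (twist_diffE _ _ fk v D0))).
  rewrite add0r -mulmxA iP !mulmx1 -mul_rV_lin1 -/A AE /Q !mulmxA -mulmxDl.
  move=> /(congr1 (mulmx^~ (invmx E))); rewrite mulmxK// mul0mx => e.
  (* [P] is a left inverse of the inclusion and kills the added directions *)
  have vP : v *m P = 0.
    move: (congr1 (mulmx^~ P) e); rewrite mul0mx mulmxDl.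
    rewrite -[v *m _ *m P]mulmxA mul_copid_mx_pid// mulmx0 addr0.
    rewrite -[X in X = _]mulmxA iP mulmx1.
    by move=> /(congr1 (mulmx^~ (invmx C))); rewrite mulmxK// mul0mx.
  move: e; rewrite vP !mul0mx add0r mulmxBr mulmx1.
  move/eqP; rewrite subr_eq0 => /eqP->.
  by rewrite -(pid_mx_id _ _ _ (leqnn p)) mulmxA vP mul0mx.
have [V [W [g [[oV _] Va VD _ [h1 _]]]]] := inverse_function oD D0 hk hinj.
have ci : continuous (fun x : 'rV[R]_p => x *m i).
  exact: (@mulmxr_continuous R p m i).
have oN : open (U `&` (fun x : 'rV[R]_p => x *m i) @^-1` V).
  by apply: openI => //; apply: open_comp => // x _; exact: ci.
exists (U `&` (fun x : 'rV[R]_p => x *m i) @^-1` V).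
  by split=> // x [].
move=> O oO OV; apply/seteqP; split=> // y Oy.
have [x [Ux Vx] fx] := OV y Oy.
pose w : 'rV[R]_m := delta_mx ord0 (Ordinal pm).
have wP : w *m P = 0 by exact: delta_mx_pid.
have hx0 : h (x *m i) = y.
  by rewrite -[x *m i]addr0 hE !mul0mx !addr0.
have nO : nbhs (x *m i) (V `&` h @^-1` O).
  apply: filterI; first exact: open_nbhs_nbhs.
  apply: (Cinf_continuous hk); first exact: VD.
  by rewrite hx0; exact: open_nbhs_nbhs.
have [t t0 /(_ t)] := line_meets_nbhs w nO.
rewrite lexx ltW// => /(_ isT)[Vt Ot].
have [x' [Ux' Vx'] fx'] := OV _ Ot.
have [_ e1] := h1 _ Vt; have [_ e2] := h1 _ Vx'.
have e3 : h (x' *m i) = h (x *m i + t *: w).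
  by rewrite -fx' -[x' *m i]addr0 hE !mul0mx !addr0.
have : x' *m i = x *m i + t *: w by rewrite -e1 -e2 e3.
move/(congr1 (mulmx^~ (copid_mx p))).
rewrite mulmxDl -!mulmxA mul_pid_mx_copid// !mulmx0 add0r -scalemxAl.
rewrite mulmxBr mulmx1 delta_mx_pid// subr0 => /esym/eqP.
rewrite scaler_eq0 gt_eqF//= => /eqP/matrixP/(_ ord0 (Ordinal pm)).
by rewrite !mxE !eqxx => /eqP; rewrite oner_eq0.
Qed.

(** Let [r] be the rank of [A]. A change of coordinates [h], with inverse [g],
    makes [r] independent linear forms of [f] equal to the first [r]
    coordinates. The differential of [f \o g] then has rank at most [r], while
    these forms are already independent on its image, hence separate the
    vectors of the image. They vanish on the image of the remaining
    directions, so [f \o g] is constant along these. *)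
Lemma constant_rank_not_injective k m (U : set 'rV[R]_k)
    (f : 'rV[R]_k -> 'rV[R]_m) a (A : 'M[R]_(k, m)) :
  open U -> U a -> Cinf U f -> lin1_mx ('d f a) = A ->
  (forall x, U x -> (\rank (lin1_mx ('d f x)) <= \rank A)%N) ->
  (\rank A < k)%N ->
  exists x x', [/\ U x, U x', x != x' & f x = f x'].
Proof.
move=> oU Ua fk AE rk rlt; have rle := ltnW rlt; pose r := \rank A.
set E := col_ebase A; have Eu : E \in unitmx by exact: col_ebase_unit.
have [P RP] := row_freeP (row_base_free A).
pose i : 'M[R]_(r, k) := pid_mx r; pose B := P *m i.
pose Q := E *m copid_mx r.
have AB : A *m B = E *m pid_mx r.
  rewrite -{1}(mulmx_base A) /B mulmxA -[_ *m row_base A *m P]mulmxA RP mulmx1.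
  by rewrite /col_base -mulmxA pid_mx_id.
pose h := twist f 0 1%:M B Q.
have aE (x : 'rV[R]_k) : 0 + x *m 1%:M = x by rewrite add0r mulmx1.
have DE : twist_dom U 0 1%:M = U.
  by apply/seteqP; split=> x; rewrite /twist_dom /= aE.
have hk : Cinf U h by rewrite -DE; exact: twist_Cinf.
have Da : twist_dom U 0 1%:M a by rewrite DE.
have hinj v : 'd h a v = 0 -> v = 0.
  move=> /(etrans (esym (twist_diffE _ _ fk v Da))).
  rewrite aE mulmx1 -mul_rV_lin1 AE -mulmxA AB /Q -mulmxDr -mulmxDr.
  rewrite /copid_mx addrC subrK mulmx1.
  by move=> /(congr1 (mulmx^~ (invmx E))); rewrite mulmxK// mul0mx.
have [V [W [g [[oV oW] Va VU gk [h1 h2]]]]] := inverse_function oU Ua hk hinj.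
pose F := f \o g.
have gU y : W y -> U (g y) by move=> /h2[/VU].
have Fk : Cinf W F by exact: (Cinf_comp oW oU gU gk fk).
have iB : B *m (pid_mx r : 'M[R]_k) = B by rewrite /B -mulmxA pid_mx_id.
have FB y : W y -> F y *m B = y *m pid_mx r.
  move=> /h2[_ e]; rewrite -[in RHS]e /h /twist aE mulmxDl.
  by rewrite -[in RHS]mulmxA iB /Q -!mulmxA mul_copid_mx_pid// !mulmx0 addr0.
pose w : 'rV[R]_k := delta_mx ord0 (Ordinal rlt).
have dF y : W y -> 'd F y w = 0.
  move=> Wy; set J := lin1_mx ('d f (g y)); set G := lin1_mx ('d g y).
  have dg : differentiable g y by exact: (Cinf_differentiable gk).
  have df : differentiable f (g y) by apply: (Cinf_differentiable fk); exact: gU.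
  have dFE (v : 'rV[R]_k) : 'd F y v = v *m G *m J.
    by apply: etrans (diff_compE v dg df) _; rewrite !mul_rV_lin1.
  have GJB (v : 'rV[R]_k) : v *m G *m J *m B = v *m pid_mx r.
    have cB := @mulmxr_continuous R m k B.
    have dFy : differentiable F y by exact: differentiable_comp.
    have dB := linear_differentiable (F y) cB.
    transitivity ('d F y v *m B); first by rewrite dFE.
    have e1 := etrans (diff_compE v dFy dB) (diff_linE _ _ cB).
    rewrite -[LHS]/(mulmxr B ('d F y v)) -e1.
    have ci := @mulmxr_continuous R k k (pid_mx r).
    have e2 := @diff_linE R _ _ (mulmxr (pid_mx r)) y v ci.
    rewrite -[RHS]/(mulmxr (pid_mx r) v) -e2.
    apply: near_diffV; last exact: linear_differentiable.
    by apply: (open_near_eq oW Wy) => z Wz /=; rewrite FB.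
  (* the [r] forms given by [P] stay independent on the row space of [J] *)
  have GJBE : G *m J *m B = pid_mx r.
    apply/row_matrixP => j; rewrite !rowE; apply: etrans (GJB (delta_mx _ j)).
    by rewrite !mulmxA.
  have rJP : (r <= \rank (J *m P))%N.
    have e : \rank (G *m J *m B) = r by rewrite GJBE rank_pid_mx.
    rewrite -{1}e /B -!mulmxA; apply: leq_trans (mxrankM_maxr _ _) _.
    by rewrite mulmxA; exact: mxrankM_maxl.
  (* as [J] has rank at most [r], they separate the vectors of that space *)
  have cap0 : (J :&: kermx P)%MS = 0.
    apply/eqP; rewrite -mxrank_eq0 -leqn0 -(leq_add2l (\rank (J *m P))).
    by rewrite mxrank_mul_ker addn0; apply: leq_trans rJP; exact/rk/gU.
  apply/eqP; rewrite -submx0 -cap0 dFE sub_capmx submxMl /=.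
  apply/sub_kermxP.
  have iU : i *m (pid_mx r : 'M[R]_(k, r)) = 1%:M by rewrite pid_mx_id// pid_mx_1.
  have qB : w *m G *m J *m P *m i = 0.
    by rewrite -mulmxA; apply: etrans (GJB w) _; exact: delta_mx_pid.
  by rewrite -[LHS]mulmx1 -iU mulmxA qB mul0mx.
have [Wa _] := h1 _ Va.
have nW : nbhs (h a) W by exact: open_nbhs_nbhs.
have [t t0 ht] := line_meets_nbhs w nW.
have Wt : W (h a + t *: w) by apply: ht; rewrite lexx ltW.
exists (g (h a)), (g (h a + t *: w)); split; [exact: gU|exact: gU| |].
  apply/eqP => /(congr1 h); rewrite (h2 _ Wa).2 (h2 _ Wt).2.
  move/eqP; rewrite -{1}[h a]addr0 (inj_eq (addrI _)) eq_sym scaler_eq0.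
  rewrite gt_eqF//= => /eqP/matrixP/(_ ord0 (Ordinal rlt)).
  by rewrite !mxE !eqxx => /eqP; rewrite oner_eq0.
have : `|F (h a + t *: w) - F (h a)| <= 0.
  apply: mean_value_le => // s /andP[s0 s1].
  have -> : h a + t *: w - h a = t *: w by rewrite addrC addKr.
  have Ws : W (h a + s *: (t *: w)).
    by rewrite scalerA; apply: ht; rewrite mulr_ge0// ?ler_piMl// ltW.
  split; first exact: (Cinf_differentiable Fk).
  by rewrite linearZ /= dF// scaler0 normr0.
by rewrite normr_le0 subr_eq0 => /eqP.
Qed.

End RankForms.

(** * Smooth maps between manifolds *)

Section SmoothMaps.
Variable R : realType.

(** Local expressions of a map between manifolds have irrelevant values away
    from a neighbourhood of the point, so only germs are meaningful. *)
Definition Cinf_at m p (x : 'rV[R]_m) (f : 'rV[R]_m -> 'rV[R]_p) :=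
  exists W, [/\ open W, W x & Cinf W f].

Lemma Cinf_at_comp m p q (x : 'rV[R]_m) (f : 'rV[R]_m -> 'rV[R]_p)
    (g : 'rV[R]_p -> 'rV[R]_q) :
  Cinf_at x f -> Cinf_at (f x) g -> Cinf_at x (g \o f).
Proof.
move=> [V [oV Vx fk]] [W [oW Wfx gk]].
have oVW : open (V `&` f @^-1` W).
  by apply: (open_pre oV _ oW) => y; exact: Cinf_continuous.
exists (V `&` f @^-1` W); split=> //.
by apply: (Cinf_comp oVW oW _ _ gk) => [y []//|]; apply: Cinf_subset fk => y [].
Qed.

Lemma Cinf_at_eq m p (x : 'rV[R]_m) (f g : 'rV[R]_m -> 'rV[R]_p) :
  (\forall y \near x, f y = g y) -> Cinf_at x f -> Cinf_at x g.
Proof.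
rewrite -nbhs_nearE nbhsE => -[V [oV Vx] Vfg] [W [oW Wx fk]].
have oVW := openI oV oW; exists (V `&` W); split=> //.
by apply: (Cinf_eq oVW _ (Cinf_subset _ fk)) => y [// /Vfg].
Qed.

Lemma Cinf_at_linear m p (L : {linear 'rV[R]_m -> 'rV[R]_p}) x : Cinf_at x L.
Proof.
exists setT; split=> //; first exact: openT.
move=> k; exact: (Ck_linl (@linear_rV_cts _ _ _ L) openT (Ck_id k setT)).
Qed.

Lemma near_cinv m (M : topologicalType) (c : chart R M m) x (A : set M) :
  cdom c x -> nbhs x A -> \forall u \near c x, A (cinv c u).
Proof.
move=> cx xA; have := cinv_cts c (cmap_cod c cx).
by apply; rewrite cmapK.
Qed.

Lemma near_ccod m (M : topologicalType) (c : chart R M m) x :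
  cdom c x -> \forall u \near c x, ccod c u.
Proof.
move=> cx; apply: open_nbhs_nbhs; split; [exact: ccod_open|exact: cmap_cod].
Qed.

Lemma near_cdom m (M : topologicalType) (c : chart R M m) x :
  cdom c x -> \forall y \near x, cdom c y.
Proof. by move=> cx; apply: open_nbhs_nbhs; split=> //; exact: cdom_open. Qed.

Lemma cmap_inj m (M : topologicalType) (c : chart R M m) x y :
  cdom c x -> cdom c y -> c x = c y -> x = y.
Proof. by move=> cx cy e; rewrite -(cmapK c cx) e cmapK. Qed.

Definition lrep m n (M : manifold R m) (N : manifold R n) (i : midx M)
  (j : midx N) (f : M -> N) : 'rV[R]_m -> 'rV[R]_n :=
  mchart j \o f \o cinv (mchart i).

Lemma lrepE m n (M : manifold R m) (N : manifold R n) (i : midx M)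
    (j : midx N) (f : M -> N) x :
  cdom (mchart i) x -> lrep i j f (mchart i x) = mchart j (f x).
Proof. by move=> ix; rewrite /lrep /= cmapK. Qed.

Lemma trans_Cinf_at m (M : manifold R m) (i j : midx M) x :
  cdom (mchart i) x -> cdom (mchart j) x -> Cinf_at (mchart i x) (trans i j).
Proof.
move=> ix jx; exists (trans_dom (mchart i) (mchart j)); split.
- exact: trans_dom_open.
- exact: trans_domx.
- exact: mcompat.
Qed.

Lemma smooth_at_lrep m n (M : manifold R m) (N : manifold R n) (f : M -> N)
    x i j :
  cdom (mchart i) x -> cdom (mchart j) (f x) -> smooth_at f x ->
  Cinf_at (mchart i x) (lrep i j f).
Proof. by move=> ix jx [_ /(_ i j ix jx)]. Qed.

Lemma lrep_differentiable m n (M : manifold R m) (N : manifold R n)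
    (f : M -> N) x i j :
  cdom (mchart i) x -> cdom (mchart j) (f x) -> smooth_at f x ->
  differentiable (lrep i j f) (mchart i x).
Proof.
move=> ix jx sf; have [W [_ Wx fk]] := smooth_at_lrep ix jx sf.
exact: Cinf_differentiable fk Wx.
Qed.

Lemma near_lrep_comp m n p (M : manifold R m) (N : manifold R n)
    (P : manifold R p) (f : M -> N) (g : N -> P) x i j l :
  cdom (mchart i) x -> cdom (mchart j) (f x) -> {for x, continuous f} ->
  \forall u \near mchart i x,
    (lrep j l g \o lrep i j f) u = lrep i l (g \o f) u.
Proof.
move=> ix jx cf; have := near_cinv ix (cf _ (near_cdom jx)).
by apply: filterS => u ju; rewrite /lrep /= cmapK.
Qed.

(** A single pair of charts suffices, transition maps being smooth; continuity
    ensures that the other local expressions factor through this one. *)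
Lemma smooth_at_chart m n (M : manifold R m) (N : manifold R n) (f : M -> N)
    x i j :
  cdom (mchart i) x -> cdom (mchart j) (f x) -> {for x, continuous f} ->
  Cinf_at (mchart i x) (lrep i j f) -> smooth_at f x.
Proof.
move=> ix jx cf fk; split=> // i' j' ix' jx'.
suff h : Cinf_at (mchart i' x) (lrep i' j' f) by exact: h.
have e : trans i' i (mchart i' x) = mchart i x by rewrite /trans /= cmapK.
have h1 : Cinf_at (mchart i' x) (lrep i j f \o trans i' i).
  by apply: Cinf_at_comp (trans_Cinf_at ix' ix) _; rewrite e.
have h2 : Cinf_at (mchart i' x) (trans j j' \o (lrep i j f \o trans i' i)).
  apply: Cinf_at_comp h1 _; rewrite /= e lrepE//.
  exact: trans_Cinf_at.
apply: Cinf_at_eq h2.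
have n1 := near_cinv ix' (near_cdom ix).
have n2 := near_cinv ix' (cf _ (near_cdom jx)).
by apply: filterS2 n1 n2 => u u1 u2; rewrite /lrep /trans /= cmapK// cmapK.
Qed.

Lemma smooth_at_eq m n (M : manifold R m) (N : manifold R n) (f g : M -> N) x :
  (\forall y \near x, f y = g y) -> smooth_at f x -> smooth_at g x.
Proof.
move=> fg sf; have [cf _] := sf; have fgx : f x = g x := nbhs_singleton fg.
have [i ix] := mcover x; have [j jx] := mcover (f x).
have cg : {for x, continuous g}.
  move: cf; rewrite /prop_for /continuous_at fgx.
  by move=> h; exact: (cvg_trans (near_eq_cvg fg) h).
have jgx : cdom (mchart j) (g x) by rewrite -fgx.
apply: (smooth_at_chart ix jgx cg).
apply: Cinf_at_eq (smooth_at_lrep ix jx sf).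
by have := near_cinv ix fg; apply: filterS => u; rewrite /lrep /= => ->.
Qed.

Lemma smooth_at_comp m n p (M : manifold R m) (N : manifold R n)
    (P : manifold R p) (f : M -> N) (g : N -> P) x :
  smooth_at f x -> smooth_at g (f x) -> smooth_at (g \o f) x.
Proof.
move=> sf sg; have [cf _] := sf; have [cg _] := sg.
have [i ix] := mcover x; have [j jx] := mcover (f x).
have [l lx] := mcover (g (f x)).
apply: (@smooth_at_chart _ _ _ _ _ _ i l) => //.
  exact: continuous_comp.
apply: Cinf_at_eq (near_lrep_comp g l ix jx cf) _.
apply: Cinf_at_comp (smooth_at_lrep ix jx sf) _.
by rewrite lrepE//; exact: smooth_at_lrep.
Qed.

Lemma diff_lrep_comp m n p (M : manifold R m) (N : manifold R n)
    (P : manifold R p) (f : M -> N) (g : N -> P) x i j l v :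
  smooth_at f x -> smooth_at g (f x) ->
  cdom (mchart i) x -> cdom (mchart j) (f x) -> cdom (mchart l) (g (f x)) ->
  'd (lrep i l (g \o f)) (mchart i x) v =
  'd (lrep j l g) (mchart j (f x)) ('d (lrep i j f) (mchart i x) v).
Proof.
move=> sf sg ix jx lx; have [cf _] := sf.
have df := lrep_differentiable ix jx sf; have dg := lrep_differentiable jx lx sg.
rewrite -(lrepE j f ix) in dg *.
rewrite -(diff_compE v df dg); apply: near_diffV; last first.
  exact: differentiable_comp.
exact: near_lrep_comp.
Qed.

Lemma smooth_at_id m (M : manifold R m) (x : M) : smooth_at (fun y : M => y) x.
Proof.
have [i ix] := mcover x.
have cid : {for x, continuous (fun y : M => y)} by move=> A.
exact: (smooth_at_chart ix ix cid (trans_Cinf_at ix ix)).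
Qed.

Lemma smooth_at_cst m n (M : manifold R m) (N : manifold R n) (y : N) (x : M) :
  smooth_at (fun _ : M => y) x.
Proof.
have [i ix] := mcover x; have [j jy] := mcover y.
have cc : {for x, continuous (fun _ : M => y)} by exact: cst_continuous.
apply: (smooth_at_chart ix jy cc); exists setT; split=> //; first exact: openT.
by move=> k; exact: Ck_cst.
Qed.

Lemma smooth_at_pair m n p (M : manifold R m) (N : manifold R n)
    (P : manifold R p) (f : M -> N) (g : M -> P) x :
  smooth_at f x -> smooth_at g x ->
  smooth_at (fun y => (f y, g y) : prod_manifold N P) x.
Proof.
move=> sf sg; have [cf _] := sf; have [cg _] := sg.
have [i ix] := mcover x; have [j jx] := mcover (f x).
have [l lx] := mcover (g x).
have jlx : cdom (@mchart _ _ (prod_manifold N P) (j, l)) (f x, g x) by [].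
have cfg : {for x, continuous (fun y => (f y, g y) : prod_manifold N P)}.
  exact: cvg_pair cf cg.
apply: (smooth_at_chart ix jlx cfg).
have [V [oV Vx fk]] := smooth_at_lrep ix jx sf.
have [W [oW Wx gk]] := smooth_at_lrep ix lx sg.
have oVW := openI oV oW; exists (V `&` W); split=> // k.
by apply: (Ck_row_mx oVW); [apply: Ck_sub (fk k)|apply: Ck_sub (gk k)] => u [].
Qed.

Lemma smooth_at_fst m n (M : manifold R m) (N : manifold R n)
    (x : prod_manifold M N) :
  smooth_at (fun z : prod_manifold M N => z.1 : M) x.
Proof.
have [i ix] := mcover x.1; have [j jx] := mcover x.2.
have ijx : cdom (@mchart _ _ (prod_manifold M N) (i, j)) x by [].
have cf : {for x, continuous (fun z : prod_manifold M N => z.1 : M)}.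
  by exact: cvg_fst.
apply: (smooth_at_chart ijx ix cf).
apply: Cinf_at_eq (Cinf_at_linear lsubmx _).
have := near_ccod ijx; apply: filterS => u [ui uj].
by rewrite /lrep /= cinvK.
Qed.

Lemma smooth_at_snd m n (M : manifold R m) (N : manifold R n)
    (x : prod_manifold M N) :
  smooth_at (fun z : prod_manifold M N => z.2 : N) x.
Proof.
have [i ix] := mcover x.1; have [j jx] := mcover x.2.
have ijx : cdom (@mchart _ _ (prod_manifold M N) (i, j)) x by [].
have cf : {for x, continuous (fun z : prod_manifold M N => z.2 : N)}.
  by exact: cvg_snd.
apply: (smooth_at_chart ijx jx cf).
apply: Cinf_at_eq (Cinf_at_linear rsubmx _).
have := near_ccod ijx; apply: filterS => u [ui uj].
by rewrite /lrep /= cinvK.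
Qed.

Lemma diff_lrep_fst m n (M : manifold R m) (N : manifold R n)
    (x : prod_manifold M N) (i : midx M) (j : midx N) v :
  cdom (mchart i) x.1 -> cdom (mchart j) x.2 ->
  'd (lrep ((i, j) : midx (prod_manifold M N)) i
     (fun z : prod_manifold M N => z.1 : M))
     (@mchart _ _ (prod_manifold M N) (i, j) x) v = lsubmx v.
Proof.
move=> ix jx.
have ijx : cdom (@mchart _ _ (prod_manifold M N) (i, j)) x by [].
have cl : continuous (lsubmx : 'rV[R]_(m + n) -> 'rV[R]_m).
  by move=> u; exact: continuous_lsubmx.
rewrite -(diff_linE (L := lsubmx)
  (@mchart _ _ (prod_manifold M N) (i, j) x) v cl).
apply: near_diffV; last exact: linear_differentiable.
have := near_ccod ijx; apply: filterS => u [ui uj].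
by rewrite /lrep /= cinvK.
Qed.

Lemma diff_lrep_pair m n (M : manifold R m) (N : manifold R n)
    (x : M) (y : N) (i : midx M) (j : midx N) v :
  cdom (mchart i) x -> cdom (mchart j) y ->
  'd (lrep j ((i, j) : midx (prod_manifold M N))
     (fun z : N => (x, z) : prod_manifold M N)) (mchart j y) v = row_mx 0 v.
Proof.
move=> ix jy; have [L1 [L2 LE]] := row_mx_lin R m n.
have cL := @linear_rV_cts _ _ _ L2.
have dc : differentiable (cst (L1 (mchart i x))) (mchart j y).
  exact: differentiable_cst.
have dL := linear_differentiable (mchart j y) cL.
transitivity ('d (fun u => cst (L1 (mchart i x)) u + L2 u) (mchart j y) v).
  apply: near_diffV; last exact: (differentiableD dc dL).
  by apply: filterS (near_ccod jy) => u ju; rewrite /lrep /= cinvK// LE.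
apply: etrans (diff_addE v dc dL) _; rewrite LE linear0; congr (_ + _).
  exact: (congr1 (fun h => h v) (diff_cst (L1 (mchart i x)) (mchart j y))).
exact: diff_linE.
Qed.

(** The local right inverse of an expression of [f] in charts, read back in
    the manifolds. The set [D] consists of the coordinate vectors at which
    this expression is meaningful and smooth. *)
Lemma local_section m n (M : manifold R m) (N : manifold R n) (f : M -> N)
    (U : set M) x i j :
  open U -> U x -> (forall y, U y -> smooth_at f y) ->
  cdom (mchart i) x -> cdom (mchart j) (f x) ->
  (forall w, exists v, 'd (lrep i j f) (mchart i x) v = w) ->
  exists (W : set N) (s : N -> M), [/\ open W, W (f x), s (f x) = x &
    forall y, W y -> [/\ U (s y), f (s y) = y & smooth_at s y]].
Proof.
move=> oU Ux sf ix jx surj.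
have [W0 [oW0 W0x fk]] := smooth_at_lrep ix jx (sf x Ux).
have oUj : open (U `&` f @^-1` cdom (mchart j)).
  by apply: open_pre => //; [move=> y /sf[]|exact: cdom_open].
pose D := W0 `&` (ccod (mchart i) `&`
  cinv (mchart i) @^-1` (U `&` f @^-1` cdom (mchart j))).
have oD : open D.
  apply: openI => //; apply: open_pre => //; first exact: ccod_open.
  exact: (@cinv_cts _ _ _ (mchart i)).
have Dx : D (mchart i x).
  by split=> //; split; [exact: cmap_cod|rewrite /= cmapK].
have DW0 : D `<=` W0 by move=> u [].
have [W1 [s [oW1 W1x sx sk h]]] :=
  local_right_inverse oD Dx (Cinf_subset DW0 fk) surj.
rewrite lrepE// in W1x sx.
exists (cdom (mchart j) `&` mchart j @^-1` W1),
  (cinv (mchart i) \o s \o mchart j); split.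
- exact: (open_pre (cdom_open (mchart j)) (@cmap_cts _ _ _ (mchart j)) oW1).
- by [].
- by rewrite /= sx cmapK.
move=> y [jy W1y].
have [[W0s [is_ [Us js]]] e] := h _ W1y.
split=> //=.
  by apply: (cmap_inj js jy); exact: e.
apply: (@smooth_at_chart _ _ _ _ _ _ j i) => //=; first exact: cinv_dom.
  have c1 : {for y, continuous (s \o mchart j)} :=
    continuous_comp (cmap_cts _ jy) (Cinf_continuous sk W1y).
  exact: (continuous_comp c1 (cinv_cts _ is_)).
apply: (@Cinf_at_eq _ _ _ s); last by exists W1.
have n1 : \forall u \near mchart j y, W1 u by exact: open_nbhs_nbhs.
apply: filterS2 n1 (near_ccod jy) => u W1u ju.
rewrite /lrep /= (cinvK _ ju) cinvK//.
by have [[_ []]] := h _ W1u.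
Qed.

(** In the chosen charts every coordinate vector represents a tangent vector. *)
Lemma submersion_lrep m n (M : manifold R m) (N : manifold R n) (f : M -> N)
    x i j :
  submersion f -> cdom (mchart i) x -> cdom (mchart j) (f x) ->
  forall w, exists v, 'd (lrep i j f) (mchart i x) v = w.
Proof.
move=> [sf df] ix jx w.
pose ci : charts_at x := exist _ i ix; pose cj : charts_at (f x) := exist _ j jx.
have [v vE] := df x (tangent_of cj w).
exists (tcoord ci v); have := tcoord_differential (sf x) ci cj v.
by rewrite vE tangent_ofK.
Qed.

End SmoothMaps.

(** * Immersions and the Baire category theorem *)

Section BaireManifold.
Variable R : realType.

(** Each set of a countable basis that is contained in some [B] keeps one of
    the corresponding sets [C]. *)
Lemma countable_subcover (T : topologicalType) (S : Type) (f : T -> S)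
    (U : set T) (K : set (set S)) : @second_countable T -> K set0 ->
  (forall x, U x -> exists B C, [/\ open B, B x, K C & f @` B `<=` C]) ->
  exists C : nat -> set S, (forall n, K (C n)) /\ f @` U `<=` \bigcup_n C n.
Proof.
move=> [D cD [oD bD]] K0 h; have /countable_injP[code inj] := cD.
have /choice[C hC] (n : nat) : exists C, K C /\ forall b, D b -> code b = n ->
    (exists2 C', K C' & f @` b `<=` C') -> f @` b `<=` C.
  have [[b [Db bn [C KC bC]]]|no] := pselect (exists b, [/\ D b, code b = n &
      exists2 C', K C' & f @` b `<=` C']).
    exists C; split=> // b' Db' b'n _; have -> // : b' = b.
    by apply: inj; rewrite ?inE// b'n.
  by exists set0; split=> // b Db bn hb; case: no; exists b.
exists C; split=> [n|_ [x Ux <-]]; first by have [] := hC n.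
have [B [C' [oB Bx KC' BC']]] := h x Ux.
have [b [Db bx] bB] := bD x B (open_nbhs_nbhs (conj oB Bx)).
exists (code b) => //; have [_ /(_ b Db erefl)] := hC (code b).
apply; last by exists x.
by exists C' => //; apply: subset_trans BC'; exact: image_subset.
Qed.

Lemma chart_image_open n (M : topologicalType) (c : chart R M n) (A : set M) :
  open A -> open (ccod c `&` cinv c @^-1` A).
Proof. exact: (open_pre (ccod_open c) (@cinv_cts _ _ _ c)). Qed.

Lemma chart_preimage_open n (M : topologicalType) (c : chart R M n)
    (A : set 'rV[R]_n) : open A -> open (cdom c `&` c @^-1` A).
Proof. exact: (open_pre (cdom_open c) (@cmap_cts _ _ _ c)). Qed.

Lemma nbhs_closed_ball_rV n (x : 'rV[R]_n) A : nbhs x A ->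
  exists2 e : R, 0 < e & closed_ball_ Num.norm x e `<=` A.
Proof.
case/nbhs_ballP => e /= e0 eA; exists (e / 2); first by rewrite divr_gt0.
move=> y; rewrite /closed_ball_ /= => xy; apply: eA; rewrite -ball_normE /=.
by apply: le_lt_trans xy _; rewrite ltr_pdivrMr// ltr_pMr// ltr1n.
Qed.

(** The Baire theorem for a closed ball contained in a chart around a point of
    [O], transported to the complete space of row vectors. *)
Lemma manifold_Baire n (M : manifold R n) (C : nat -> set M) (O : set M) :
  (forall k, closed (C k)) ->
  (forall k A, open A -> A `<=` C k -> A = set0) ->
  open O -> O `<=` \bigcup_k C k -> O = set0.
Proof.
move=> cC eC oO OC; apply/seteqP; split=> // y Oy.
have [j jy] := mcover y; set c := mchart j in jy.
have nO : nbhs (c y) (ccod c `&` cinv c @^-1` O).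
  apply: open_nbhs_nbhs; split; first exact: chart_image_open.
  by split; [exact: cmap_cod|rewrite /= cmapK].
have [e e0 eO] := nbhs_closed_ball_rV nO.
set D := closed_ball_ Num.norm (c y) e in eO.
have cD : closed D by exact: closed_closed_ball_.
pose F k : set (rV_completeNormed R n) :=
  ~` D `|` (ccod c `&` cinv c @^-1` (~` C k)).
have odF k : open (F k) /\ dense (F k).
  split.
    apply: openU; first exact: closed_openC.
    by apply: chart_image_open; exact: closed_openC.
  move=> G [u Gu] oG.
  have [GD|] := pselect (G `<=` D); last first.
    by move=> /existsNP[v /not_implyP[Gv Dv]]; exists v; split=> //; left.
  have Gc : G `<=` ccod c by move=> v /GD/eO[].
  (* otherwise [G] lies in the chart and is open in [M], so it is not in [C k] *)
  have oA := chart_preimage_open c oG.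
  have [AC|] := pselect (cdom c `&` c @^-1` G `<=` C k).
    have := eC k _ oA AC; move/seteqP => [/(_ (cinv c u)) h _]; exfalso.
    apply: h; split; first exact: cinv_dom (Gc _ Gu).
    by rewrite /= cinvK//; exact: Gc.
  move=> /existsNP[z /not_implyP[[cz Gz] Cz]]; exists (c z); split=> //; right.
  by split; [exact: cmap_cod|rewrite /= cmapK].
have oball : open (ball (c y) e) by exact: ball_open.
have ne : ball (c y) e !=set0 by exists (c y); exact: ballxx.
have [u [Bu Fu]] := @Baire R (rV_completeNormed R n) F odF _ ne oball.
have Du : D u.
  by move: Bu; rewrite /D /closed_ball_ -ball_normE /=; exact: ltW.
have [cu Ou] := eO u Du; have [k _ Cu] := OC _ Ou.
by have [/(_ Du)//|[_]] := Fu k I; apply.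
Qed.

(** A closed ball in a chart is compact, so its image is closed; it has no
    interior by [immersion_image_interior]. *)
Lemma immersion_image_small p q (P : manifold R p) (Q : manifold R q)
    (f : P -> Q) (U : set P) x i j :
  (p < q)%N -> open U -> U x -> (forall y, U y -> smooth_at f y) ->
  cdom (mchart i) x -> cdom (mchart j) (f x) ->
  (forall v, 'd (lrep i j f) (mchart i x) v = 0 -> v = 0) ->
  exists B C, [/\ open B, B x, closed C /\
    (forall A, open A -> A `<=` C -> A = set0) & f @` B `<=` C].
Proof.
move=> pq oU Ux sf ix jx inj.
have [W0 [oW0 W0x fk]] := smooth_at_lrep ix jx (sf x Ux).
have oUj : open (U `&` f @^-1` cdom (mchart j)).
  apply: (open_pre oU _ (cdom_open (mchart j))) => y Uy.
  by have [] := sf y Uy.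
pose D := W0 `&` (ccod (mchart i) `&`
  cinv (mchart i) @^-1` (U `&` f @^-1` cdom (mchart j))).
have oD : open D by apply: openI => //; exact: chart_image_open.
have Dx : D (mchart i x).
  by split=> //; split; [exact: cmap_cod|rewrite /= cmapK].
have DW0 : D `<=` W0 by move=> u [].
have [V [oV Vx VD] hV] :=
  immersion_image_interior pq oD Dx (Cinf_subset DW0 fk) inj.
have [e e0 eV] := nbhs_closed_ball_rV (open_nbhs_nbhs (conj oV Vx)).
set K := closed_ball_ Num.norm (mchart i x) e in eV.
have cK : compact K.
  apply: bounded_closed_compact; last exact: closed_closed_ball_.
  exists (`|mchart i x| + e); split; first exact: num_real.
  move=> r hr y; rewrite /K /closed_ball_ /= => hy.
  rewrite -[y](subKr (mchart i x)); apply: le_trans (ler_normB _ _) _.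
  by apply: le_trans (ltW hr); rewrite lerD2l.
pose g := f \o cinv (mchart i).
have cg u : D u -> {for u, continuous g}.
  move=> [_ [iu [Uu _]]]; have [cf _] := sf _ Uu.
  exact: (continuous_comp (cinv_cts _ iu) cf).
have KD : K `<=` D by apply: subset_trans VD.
exists (cdom (mchart i) `&` mchart i @^-1` ball (mchart i x) e), (g @` K).
split.
- by apply: chart_preimage_open; exact: ball_open.
- by split=> //=; exact: ballxx.
- split.
    apply: compact_closed; first exact: mhausdorff.
    apply: continuous_compact cK; apply: continuous_in_subspaceT => u.
    by rewrite inE => /KD; exact: cg.
  move=> A oA AK; apply/seteqP; split=> // z Az.
  have h : ccod (mchart j) `&` cinv (mchart j) @^-1` A `<=` lrep i j f @` V.
    move=> u [ju /AK[v Kv gv]]; exists v; first exact: eV.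
    by rewrite /lrep /= -[RHS](cinvK _ ju) -gv.
  have := hV _ (chart_image_open oA) h.
  move/seteqP => [/(_ (mchart j z)) + _]; apply.
  have [v Kv gv] := AK z Az; have [_ [_ [_ jz]]] := KD v Kv.
  have {}jz : cdom (mchart j) z by rewrite -gv.
  by split; [exact: cmap_cod|rewrite /= cmapK].
move=> _ [y [iy By] <-]; exists (mchart i y); last by rewrite /g /= cmapK.
by move: By; rewrite /K /closed_ball_ -ball_normE /=; exact: ltW.
Qed.

(** If [p < q], then [U] is covered by countably many open sets whose images
    lie in closed sets with empty interior, and the images would not cover
    [O]. *)
Lemma immersion_onto_open_dim p q (P : manifold R p) (Q : manifold R q)
    (f : P -> Q) (U : set P) (O : set Q) :
  open U -> (forall y, U y -> smooth_at f y) ->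
  (forall x i j, U x -> cdom (mchart i) x -> cdom (mchart j) (f x) ->
    forall v, 'd (lrep i j f) (mchart i x) v = 0 -> v = 0) ->
  open O -> O !=set0 -> O `<=` f @` U -> (q <= p)%N.
Proof.
move=> oU sf inj oO [y0 Oy0] OU; rewrite leqNgt; apply/negP => pq.
pose small : set (set Q) :=
  [set C | closed C /\ forall A, open A -> A `<=` C -> A = set0].
have s0 : small set0 by split; [exact: closed0|by move=> A _; rewrite subset0].
have h x : U x -> exists B C, [/\ open B, B x, small C & f @` B `<=` C].
  move=> Ux; have [i ix] := mcover x; have [j jx] := mcover (f x).
  exact: (immersion_image_small pq oU Ux sf ix jx (inj _ _ _ Ux ix jx)).
have [C [hC UC]] := countable_subcover (msecond_countable P) s0 h.
have := @manifold_Baire _ Q C O (fun n => (hC n).1) (fun n => (hC n).2) oO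
  (subset_trans OU UC).
by move/seteqP => [/(_ y0 Oy0)].
Qed.

End BaireManifold.

(** * Free actions with smooth quotient *)

Section FreeActions.
Variable R : realType.

Section Orbits.
Variables (m k : nat) (N : manifold R m) (G : lie_group R k).
Variables (act : N -> G -> N) (hact : right_action act).
Hypothesis free : forall z a, act z a = z -> a = lone G.

Lemma smooth_at_orbit z a : smooth_at (fun b : G => act z b) a.
Proof.
apply: (@smooth_at_comp _ _ _ _ _ (prod_manifold N G) _
  (fun b : G => (z, b)) (fun p => act p.1 p.2)).
  by apply: smooth_at_pair; [exact: smooth_at_cst|exact: smooth_at_id].
exact: ract_smooth hact _.
Qed.

Lemma smooth_at_translate a z : smooth_at (fun w : N => act w a) z.
Proof.
apply: (@smooth_at_comp _ _ _ _ _ (prod_manifold N G) _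
  (fun w : N => (w, a)) (fun p => act p.1 p.2)).
  by apply: smooth_at_pair; [exact: smooth_at_id|exact: smooth_at_cst].
exact: ract_smooth hact _.
Qed.

Lemma smooth_at_rmul (c a : G) : smooth_at (fun b : G => lmul b c) a.
Proof.
apply: (@smooth_at_comp _ _ _ _ _ (prod_manifold G G) _
  (fun b : G => (b, c)) (fun p => lmul p.1 p.2)).
  by apply: smooth_at_pair; [exact: smooth_at_id|exact: smooth_at_cst].
exact: (lmul_smooth (l := G)).
Qed.

Lemma orbit_inj z a b : act z a = act z b -> a = b.
Proof.
move=> e; have : act z (lmul a (linv b)) = z.
  by rewrite ractM// e -ractM// lmulgV ract1.
move/free => h; rewrite -[a]lmulg1 -(lmulVg (l := G) b).
by rewrite (lmulA (l := G)) h lmul1g.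
Qed.

(** With [c = a^-1 a'], the orbit map factors as [b |-> (z . (b c^-1)) . c],
    and right multiplication by [c^-1] maps [a'] to [a]; by the chain rule its
    differential at [a] is a factor of its differential at [a']. *)
Lemma orbit_rank_le z a a' i i' j j' :
  cdom (mchart i) a -> cdom (mchart i') a' ->
  cdom (mchart j) (act z a) -> cdom (mchart j') (act z a') ->
  (\rank (lin1_mx ('d (lrep i' j' (act z)) (mchart i' a'))) <=
   \rank (lin1_mx ('d (lrep i j (act z)) (mchart i a))))%N.
Proof.
move=> ia ia' ja ja'; pose c := lmul (linv a) a'.
pose rm := fun b : G => lmul b (linv c).
have ca : lmul a c = a' by rewrite /c (lmulA (l := G)) lmulgV lmul1g.
have rma' : rm a' = a.
  by rewrite /rm -ca -(lmulA (l := G)) lmulgV lmulg1.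
have E : (fun w => act w c) \o (act z \o rm) = act z.
  apply/funext => b; rewrite /rm /= -ractM//.
  by rewrite -(lmulA (l := G)) lmulVg lmulg1.
have s1 : smooth_at rm a' := smooth_at_rmul _ _.
have s2 : smooth_at (act z) (rm a') := smooth_at_orbit _ _.
have s3 : smooth_at (fun w => act w c) (act z (rm a')) := smooth_at_translate _ _.
have s12 := smooth_at_comp s1 s2.
have ia2 : cdom (mchart i) (rm a') by rewrite rma'.
have ja2 : cdom (mchart j) (act z (rm a')) by rewrite rma'.
have ja3 : cdom (mchart j') (act (act z (rm a')) c).
  by rewrite rma' -ractM// ca.
pose J1 := lin1_mx ('d (lrep i' i rm) (mchart i' a')).
pose J3 := lin1_mx ('d (lrep j j' (fun w => act w c)) (mchart j (act z (rm a')))).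
pose J := lin1_mx ('d (lrep i j (act z)) (mchart i a)).
pose J' := lin1_mx ('d (lrep i' j' (act z)) (mchart i' a')).
have J'E : J' = J1 *m J *m J3.
  apply/row_matrixP => l; rewrite !rowE !mulmxA !mul_rV_lin1.
  have e1 := diff_lrep_comp (delta_mx ord0 l) s12 s3 ia' ja2 ja3.
  rewrite E in e1; apply: etrans e1 _; congr ('d _ _ _).
  have e2 := diff_lrep_comp (delta_mx ord0 l) s1 s2 ia' ia2 ja2.
  by apply: etrans e2 _; rewrite rma'.
suff : (\rank J' <= \rank J)%N by [].
by rewrite J'E; apply: leq_trans (mxrankM_maxl _ _) _; exact: mxrankM_maxr.
Qed.

(** The orbit map has constant rank by [orbit_rank_le] and is injective, so
    its rank is the dimension of the group. *)
Lemma orbit_immersion z a i j :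
  cdom (mchart i) a -> cdom (mchart j) (act z a) ->
  forall v, 'd (lrep i j (act z)) (mchart i a) v = 0 -> v = 0.
Proof.
move=> ia ja.
have [W [oW Wa fk]] := smooth_at_lrep ia ja (smooth_at_orbit z a).
have oV : open (setT `&` act z @^-1` cdom (mchart j)).
  apply: (open_pre openT _ (cdom_open (mchart j))) => b _.
  by have [] := smooth_at_orbit z b.
pose D := W `&` (ccod (mchart i) `&`
  cinv (mchart i) @^-1` (setT `&` act z @^-1` cdom (mchart j))).
have oD : open D by apply: openI => //; exact: chart_image_open.
have Da : D (mchart i a).
  by split=> //; split; [exact: cmap_cod|rewrite /= cmapK].
have DW : D `<=` W by move=> u [].
pose A := lin1_mx ('d (lrep i j (act z)) (mchart i a)).
have rk u : D u -> (\rank (lin1_mx ('d (lrep i j (act z)) u)) <= \rank A)%N.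
  move=> [_ [iu [_ ju]]].
  by have := orbit_rank_le ia (cinv_dom _ iu) ja ju; rewrite cinvK.
have rA : row_free A.
  rewrite /row_free eqn_leq rank_leq_row leqNgt; apply/negP => rlt.
  have [u [u' [Du Du' uu' e]]] :=
    constant_rank_not_injective oD Da (Cinf_subset DW fk) erefl rk rlt.
  move: Du Du' => [_ [iu [_ ju]]] [_ [iu' [_ ju']]].
  move/eqP: uu'; apply; rewrite -(cinvK _ iu) -(cinvK _ iu'); congr (mchart i _).
  exact/orbit_inj/(cmap_inj ju ju').
move=> v v0; apply: (row_free_inj rA); rewrite mul0mx.
by apply: etrans (mul_rV_lin1 _ _) v0.
Qed.

End Orbits.

(** For a local section [s] of [psi], the trivialization is [(psi, phi)] where
    [phi z] carries [s (psi z)] to [z]. Freeness determines [phi] and makes it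
    equivariant, but it is only chosen pointwise: it is smooth because it is a
    component of the local sections of [Psi]. *)
Lemma free_action_principal n m k (M : manifold R n) (N : manifold R m)
    (G : lie_group R k) (psi : N -> M) (act : N -> G -> N) :
  submersion psi -> (forall x, exists z, psi z = x) -> right_action act ->
  (forall z a, psi (act z a) = psi z) ->
  (forall z w, psi z = psi w -> exists a, act z a = w) ->
  (forall z a, act z a = z -> a = lone G) ->
  principal_bundle psi act.
Proof.
move=> sub surj hact inv trans free.
have spsi : smooth psi by case: sub.
have cpsi : continuous psi by move=> z; have [] := spsi z.
have sect x : exists (W : set M) (s : M -> N), [/\ open W, W x &
    forall y, W y -> psi (s y) = y /\ smooth_at s y].
  have [z <-] := surj x.
  have [i iz] := mcover z; have [j jz] := mcover (psi z).
  have [W [s [oW Wz _ h]]] := local_section openT I (fun y _ => spsi y) iz jz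
    (submersion_lrep sub iz jz).
  by exists W, s; split=> // y /h[].
split=> //.
- move=> z w; split=> [|[a <-]]; first exact: trans.
  by rewrite inv.
- move=> V; split=> [oV|oV]; first by apply: open_comp => // z _; exact: cpsi.
  apply: openP => x Vx; have [W [s [oW Wx h]]] := sect x.
  exists (W `&` s @^-1` (psi @^-1` V)); split.
  + by apply: (open_pre oW _ oV) => y /h[_ []].
  + by split=> //=; have [-> _] := h x Wx.
  + by move=> y [/h[+ _]] /=; rewrite /preimage /= => ->.
move=> x0; have [W [s [oW Wx0 h]]] := sect x0.
have /choice[phi phiE] (z : N) : exists a : G,
    W (psi z) -> act (s (psi z)) a = z.
  have [Wz|] := pselect (W (psi z)); last by exists (lone G).
  have [a az] := trans (s (psi z)) z (h _ Wz).1.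
  by exists a.
pose P : manifold R (n + k) := prod_manifold M G.
pose Psi (p : P) : N := act (s p.1) p.2.
pose D : set P := W `*` setT.
have oD : open D by exact: prod_open oW openT.
have psiPsi p : D p -> psi (Psi p) = p.1.
  by move=> [Wp _]; rewrite /Psi inv (h _ Wp).1.
have Psi_inj p q : D p -> D q -> Psi p = Psi q -> p = q.
  move=> Dp Dq e; have e1 : p.1 = q.1 by rewrite -(psiPsi p)// -(psiPsi q)// e.
  move: e; rewrite /Psi e1 => /(orbit_inj hact free) e2.
  by rewrite [p]surjective_pairing [q]surjective_pairing e1 e2.
have sPsi p : D p -> smooth_at Psi p.
  move=> [Wp _]; have [_ sp] := h _ Wp.
  apply: (@smooth_at_comp _ _ _ _ _ (prod_manifold N G) _
    (fun q : P => (s q.1, q.2)) (fun q => act q.1 q.2)); last first.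
    exact: ract_smooth hact _.
  apply: smooth_at_pair; last exact: smooth_at_snd.
  exact: (smooth_at_comp (smooth_at_fst p) sp).
have dPsi_inj (p : P) (ij : midx P) (j : midx N) : D p ->
    cdom (mchart ij) p -> cdom (mchart j) (Psi p) ->
    forall v, 'd (lrep ij j Psi) (mchart ij p) v = 0 -> v = 0.
  case: ij p => i1 i2 [x a] Dp ip jp v v0; have [i1x i2a] := ip.
  have Wx : W x := Dp.1.
  (* the component along [M] is read off [psi \o Psi], which is [fst] on [D] *)
  have l0 : lsubmx v = 0.
    rewrite -(diff_lrep_fst (x := (x, a) : prod_manifold M G) v i1x i2a).
    have i1p : cdom (mchart i1) (psi (Psi (x, a))) by rewrite psiPsi.
    have e := diff_lrep_comp v (sPsi _ Dp) (spsi _) ip jp i1p.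
    rewrite v0 linear0 in e; rewrite -[RHS]e.
    have nD : \forall q \near ((x, a) : P), D q.
      by apply: open_nbhs_nbhs.
    apply: near_diffV.
      apply: filterS (near_cinv ip nD) => u Du.
      by rewrite /lrep /=; congr (mchart i1 _); exact: psiPsi.
    apply: (lrep_differentiable ip i1p).
    exact: (smooth_at_comp (sPsi _ Dp) (spsi _)).
  (* what remains is a vector killed by the orbit map of [s x] *)
  have r0 : rsubmx v = 0.
    apply: (orbit_immersion hact free i2a jp).
    have sp : smooth_at (fun b : G => (x, b) : P) a.
      by apply: smooth_at_pair; [exact: smooth_at_cst|exact: smooth_at_id].
    have e := diff_lrep_comp (rsubmx v) sp (sPsi _ Dp) i2a ip jp.
    apply: etrans e _; rewrite (diff_lrep_pair _ i1x i2a) -l0 hsubmxK.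
    exact: v0.
  by rewrite -[v]hsubmxK l0 r0 row_mx0.
have [z0 z0E] := surj x0.
have PsiE z : W (psi z) -> Psi (psi z, phi z) = z.
  by move=> Wz; rewrite /Psi /= phiE.
have oU : open (psi @^-1` W) by apply: open_comp => // z _; exact: cpsi.
(* [Psi] is an immersion onto [psi^-1 W] *)
have dim : (m <= n + k)%N.
  apply: (immersion_onto_open_dim oD sPsi _ oU) => //.
    by exists z0; rewrite /= z0E.
  by move=> z Wz; exists (psi z, phi z); [split|exact: PsiE].
have dPsi_surj (p : P) (ij : midx P) (j : midx N) : D p ->
    cdom (mchart ij) p -> cdom (mchart j) (Psi p) ->
    forall w, exists v, 'd (lrep ij j Psi) (mchart ij p) v = w.
  move=> Dp ip jp w; set A := lin1_mx ('d (lrep ij j Psi) (mchart ij p)).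
  have rA : row_free A.
    apply: inj_row_free => v /(etrans (esym (mul_rV_lin1 _ _))).
    exact: (dPsi_inj p ij j).
  have /row_fullP[B BA] : row_full A.
    by rewrite /row_full eqn_leq rank_leq_col (eqP rA).
  exists (w *m B); apply: etrans (esym (mul_rV_lin1 _ _)) _.
  by rewrite -mulmxA BA mulmx1.
exists W, phi; split=> //; last first.
  move=> z a Wz; apply: (orbit_inj hact free (z := s (psi z))).
  by rewrite ractM// phiE// -{1}(inv z a) phiE// inv.
split=> //; split=> //; split.
  move=> z Wz; set p : P := (psi z, phi z).
  have Dp : D p by split.
  have Ez : Psi p = z by exact: PsiE.
  have [ij ip] := mcover p; have [j jp] := mcover (Psi p).
  have [W' [s' [oW' W'z _ hs']]] :=
    local_section oD Dp sPsi ip jp (dPsi_surj p ij j Dp ip jp).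
  (* the local section of [Psi] is the trivialization, as [Psi] is injective *)
  rewrite Ez in W'z; apply: (@smooth_at_eq _ _ _ _ _ s'); last first.
    by have [] := hs' z W'z.
  have : nbhs z W' by exact: open_nbhs_nbhs.
  apply: filterS => y /hs'[Dy e _].
  have yE : psi y = (s' y).1 by rewrite -{1}e psiPsi.
  have Wy : W (psi y) by rewrite yE; exact: Dy.1.
  by apply: Psi_inj => //; rewrite e PsiE.
exists Psi; split; first exact: sPsi.
split.
- by move=> z Wz; split.
- by move=> p Dp; rewrite /= psiPsi//; exact: Dp.1.
- by move=> z; exact: PsiE.
- move=> p Dp; apply: Psi_inj => //.
    by split=> //; rewrite psiPsi//; exact: Dp.1.
  by rewrite PsiE// psiPsi//; exact: Dp.1.
Qed.

End FreeActions.

Theorem theorem6 (R : realType) (n : nat) (M : manifold R n) (lam : sspace M)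
  (hrigid : rigid_base_change lam)
  (hfree : forall (z : ss_N lam) (a : ss_O lam),
     ss_act lam z a = z -> a = lone (ss_O lam)) :
  principal_bundle (ss_psi lam) (ss_act lam).
Proof.
apply: free_action_principal hfree.
- exact: ss_psi_submersion.
- exact: ss_psi_surjective.
- exact: ss_act_action.
- exact: ss_psi_act.
- exact: ss_act_transitive.
Qed.
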